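(* There exists a 2.5D terrain $T$ with $n$ vertices and prickliness $\pi(T)$, and a viewpoint on $T$ with viewshed complexity $\Theta(n\cdot\pi(T))$.
   Context: A 2.5D terrain (TIN) $T$ is a triangulated $xy$-monotone polyhedral surface in $\mathbb{R}^3$; two vertices are neighbors if they are joined by an edge of the triangulation. A vertex is internal if it is not on the boundary of the triangulation (not incident to the unbounded face of the triangulation projected to the $xy$-plane). A vertex $v$ is convex if there is a non-vertical plane through $v$ that leaves all neighboring points of $v$ on $T$ below it. For a vector $\vec w\in\mathbb{R}^3$, a vertex $v$ is a local maximum of $T$ in direction $\vec w$ if $\langle v,\vec w\rangle > \langle u,\vec w\rangle$ for every neighbor $u$ of $v$. Let $\pi_{\vec w}(T)$ be the number of internal and convex vertices of $T$ that are local maxima of $T$ in direction $\vec w$. The prickliness of $T$ is $\pi(T)=\max_{\vec w}\pi_{\vec w}(T)$ (equivalently, the maximum over all invertible affine transformations $A$ of $\mathbb{R}^3$ of the number of internal and convex vertices of $T$ that are local maxima, in the vertical direction, of $A(T)$). Two points on or above $T$ are mutually visible if the segment joining them does not intersect the interior of the terrain (the region strictly below $T$). The viewshed of a viewpoint $p$ is the set of all points of $T$ visible from $p$. The viewshed is a union of parts of triangles of $T$, viewed as a set of polygons; its complexity is the total number of vertices of these polygons. The statement is meant as a lower-bound construction showing that the upper bound $O(n\cdot\pi(T))$ on the complexity of a viewshed in a 2.5D terrain is best possible. *)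

(* Defs.v *)
From HB Require Import structures.
From mathcomp Require Import all_boot all_order all_algebra.
From mathcomp Require Import all_classical all_reals all_analysis.

Set Implicit Arguments.
Unset Strict Implicit.
Unset Printing Implicit Defensive.

Import Order.TTheory GRing.Theory Num.Theory.
Import numFieldNormedType.Exports.

Local Open Scope classical_set_scope.
Local Open Scope ring_scope.

(* For q : pt3 R, q.1 is the projection to the xy-plane and q.2 the height. *)
Notation pt2 R := (R^o * R^o)%type.
Notation pt3 R := (R^o * R^o * R^o)%type.

Definition dot3 (R : realType) (v w : pt3 R) : R :=
  v.1.1 * w.1.1 + v.1.2 * w.1.2 + v.2 * w.2.

(* Twice the signed area of the triangle abc. *)
Definition signed_area (R : realType) (a b c : pt2 R) : R :=
  (b.1 - a.1) * (c.2 - a.2) - (c.1 - a.1) * (b.2 - a.2).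

(* The convex hull of the points pos i, i \in s; it is empty if s = set0. *)
Definition hull (R : realType) (V : lmodType R) (n : nat) (pos : 'I_n -> V)
    (s : {set 'I_n}) : set V :=
  [set q | exists a : 'I_n -> R, [/\ forall i, 0 <= a i,
     \sum_(i in s) a i = 1 & q = \sum_(i in s) a i *: pos i]].

(* A terrain with n vertices, given by the positions of its vertices and the
   vertex sets of its triangles. The projections of the triangles form a
   geometric simplicial complex, so the surface is xy-monotone and every
   vertex on an edge is an endpoint of that edge. The last two fields say that
   the triangulated region of the plane is bounded by a simple polygon: it is
   in one piece, is not pinched at a vertex, and has no holes. *)
Record terrain (R : realType) (n : nat) := Terrain {
  vtx : 'I_n -> pt3 R;
  faces : {set {set 'I_n}};
  xy := fun i => (vtx i).1;
  domain : set (pt2 R) :=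
    \bigcup_(f in [set f | f \in faces]) hull xy f;
  card_face : forall f, f \in faces -> #|f| = 3%N;
  face_nondegenerate : forall f i j k, f \in faces ->
    i \in f -> j \in f -> k \in f -> i != j -> j != k -> i != k ->
    signed_area (xy i) (xy j) (xy k) != 0;
  faces_cover : forall i, exists2 f, f \in faces & i \in f;
  faces_meet : forall f g, f \in faces -> g \in faces ->
    hull xy f `&` hull xy g = hull xy (f :&: g)%SET;
  domain_interior_connected : connected domain°;
  domain_compl_connected : connected (~` domain)
}.

Section Terrain.
Variables (R : realType) (n : nat) (T : terrain R n).
Implicit Types (p q : pt3 R) (i j : 'I_n) (f : {set 'I_n}).

Definition face3 f : set (pt3 R) := hull (vtx T) f.

Definition surface : set (pt3 R) :=
  \bigcup_(f in [set f | f \in faces T]) face3 f.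

Definition neighbors i j : Prop :=
  i != j /\ exists f, [/\ f \in faces T, i \in f & j \in f].

(* The complement of the domain is connected, hence is the unbounded face. *)
Definition internal_vertex i : Prop := (domain T)° (xy T i).

Definition convex_vertex i : Prop :=
  let v := vtx T i in
  exists a b : R, \forall q \near v, surface q -> q <> v ->
    q.2 < v.2 + a * (q.1.1 - v.1.1) + b * (q.1.2 - v.1.2).

Definition local_max (w : pt3 R) i : Prop :=
  forall j, neighbors i j -> dot3 (vtx T j) w < dot3 (vtx T i) w.

Definition prickliness_dir (w : pt3 R) : nat :=
  #|[set i | `[< [/\ internal_vertex i, convex_vertex i & local_max w i] >]]%SET|.

(* The maximum over w of prickliness_dir w, which takes values in {0, .., n}. *)
Definition prickliness : nat :=
  (\max_(k < n.+1 | `[< exists w, prickliness_dir w = k >]) k)%N.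

Definition strictly_below : set (pt3 R) :=
  [set q | exists q', [/\ surface q', q'.1 = q.1 & q.2 < q'.2]].

Definition segment3 p q : set (pt3 R) :=
  [set (1 - t) *: p + t *: q | t in [set t : R | 0 <= t <= 1]].

Definition visible p q : Prop := segment3 p q `&` strictly_below = set0.

Definition viewshed p : set (pt3 R) := [set q | surface q /\ visible p q].

(* The part of the viewshed on the triangle f, seen in the xy-plane: the
   projection is affine and injective on f, so it preserves polygons and their
   vertices. *)
Definition visible_part p f : set (pt2 R) :=
  [set q.1 | q in face3 f `&` viewshed p].

(* A polygon of the viewshed on f is represented by its interior; isolated
   points and segments of the visible part do not count as polygons. *)
Definition visible_polygon p f (C : set (pt2 R)) : Prop :=
  exists2 x, (visible_part p f)° x &
    C = connected_component (visible_part p f)° x.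

End Terrain.

Definition half_plane_near (R : realType) (C : set (pt2 R)) (q : pt2 R) :=
  exists a b : R, \forall x \near q,
    C x <-> 0 < a * (x.1 - q.1) + b * (x.2 - q.2).

(* The vertices of a polygon with interior C: the boundary points at which the
   boundary is not straight. *)
Definition polygon_vertex (R : realType) (C : set (pt2 R)) (q : pt2 R) :=
  [/\ closure C q, ~ C q & ~ half_plane_near C q].

(* Every polygon counts its own vertices, so the vertices are tagged with the
   triangle and the polygon they belong to. *)
Definition viewshed_vertices (R : realType) (n : nat) (T : terrain R n)
    (p : pt3 R) : set ({set 'I_n} * set (pt2 R) * pt2 R) :=
  [set u | [/\ u.1.1 \in faces T, visible_polygon T p u.1.1 u.1.2 &
               polygon_vertex u.1.2 u.2]].

Definition has_viewshed_complexity (R : realType) (n : nat) (T : terrain R n)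
    (p : pt3 R) (m : nat) : Prop :=
  (viewshed_vertices T p #= `I_m)%card.

(* Main.v *)
(* All vertices lie at height 0, except k apexes which are the only internal convex
   vertices, so the prickliness is k. The viewpoint is the origin, at height 0. The
   points e 0, .., e L of a parabola cut the quadrant seen from the origin into
   sectors, every other one of the first 2k being blocked by a pyramid; since the
   rest of the terrain is flat, the pyramids cast k separate unbounded shadows, with
   k gaps in between. Beyond the parabola the flat terrain is cut into long triangles
   e 0, e i, e (i + 1), and for i >= 2k each of these crosses all the gaps. So there
   are about k (L - 2k) visible polygons with a vertex of their own, while the
   visible part of each triangle consists of at most k polygons, each with at most
   five sides. *)
Require Import Defs.
From HB Require Import structures.
From mathcomp Require Import all_boot all_order all_algebra.
From mathcomp Require Import all_classical all_reals all_analysis.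
From mathcomp Require Import ring lra zify.

Set Implicit Arguments.
Unset Strict Implicit.
Unset Printing Implicit Defensive.

Import Order.TTheory GRing.Theory Num.Theory.
Import numFieldNormedType.Exports.

Local Open Scope classical_set_scope.
Local Open Scope ring_scope.

(** * Plane geometry *)

Section Planar.
Variable R : realType.
Implicit Types (x y d : pt2 R) (l : R * R * R).

(** Keeping the viewpoint at the height of the flat part makes visibility there a matter of
    direction alone: the segment to a flat point stays at height 0 and is blocked exactly when it
    enters the cone of directions of a pyramid. Shadows are therefore bounded by rays from 0, and
    beyond the parabola each visible polygon is an open triangle cut by a cone. Being convex, it is
    connected, so the components can be identified. The obstacle is to have many vertices but few
    convex ones. Each internal vertex [e j] must lie inside a segment of the surface at height 0;
    the rays from 0 provide it, which is why pyramids fill sectors bounded by these rays and leave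
    the rays themselves flat. The two bounds are proved differently. From below, one explicit corner
    per long triangle and gap is enough: the point where a ray bounding the gap meets the side of
    the triangle nearer to [e 0] in the fan order. From above, the actual corners are never
    computed: a vertex of an intersection of half-planes is a crossing of two of their boundary
    lines, so it suffices to count pairs of lines. *)

Definition aff l x : R := l.1.1 * x.1 + l.1.2 * x.2 + l.2.

Lemma pt2_ind (P : pt2 R -> Prop) : (forall a b : R, P (a, b)) -> forall x, P x.
Proof. by move=> H [a b]; exact: H. Qed.

Lemma affE l (a b : R) : aff l (a, b) = l.1.1 * a + l.1.2 * b + l.2.
Proof. by []. Qed.

Lemma areaE (a1 a2 b1 b2 c1 c2 : R) :
  signed_area ((a1, a2) : pt2 R) (b1, b2) (c1, c2) =
  (b1 - a1) * (c2 - a2) - (c1 - a1) * (b2 - a2) :> R.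
Proof. by []. Qed.

Lemma pairD (a b c d : R) : ((a, b) : pt2 R) + (c, d) = (a + c, b + d).
Proof. by []. Qed.

Lemma pairZ (t a b : R) : t *: ((a, b) : pt2 R) = (t * a, t * b).
Proof. by []. Qed.

Lemma pairN (a b : R) : - ((a, b) : pt2 R) = (- a, - b).
Proof. by []. Qed.

Definition ptE := (pairN, pairZ, pairD, areaE, affE).

Lemma aff_move l x d (e : R) :
  aff l (x + e *: d) = aff l x + e * (l.1.1 * d.1 + l.1.2 * d.2).
Proof.
by elim/pt2_ind: x => x1 x2; elim/pt2_ind: d => d1 d2; rewrite !ptE /=; ring.
Qed.

Lemma slope_move (a b : R) x d (e : R) :
  a * ((x + e *: d).1 - x.1) + b * ((x + e *: d).2 - x.2) =
  e * (a * d.1 + b * d.2).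
Proof.
by elim/pt2_ind: x => x1 x2; elim/pt2_ind: d => d1 d2; rewrite !ptE /=; ring.
Qed.

Lemma aff_shrink l x (t : R) : aff l (t *: x) = t * aff l x + (1 - t) * aff l 0.
Proof. by elim/pt2_ind: x => a b; rewrite !ptE /aff /=; ring. Qed.

Lemma aff_continuous l : continuous (aff l : pt2 R -> R^o).
Proof.
move=> x; rewrite /aff; apply: cvgD; last exact: cvg_cst.
by apply: cvgD; apply: cvgM; [exact: cvg_cst|exact: cvg_fst|exact: cvg_cst|exact: cvg_snd].
Qed.

Lemma aff_gt0_near l x : 0 < aff l x -> \forall y \near x, 0 < aff l y.
Proof. by move=> lx; apply: (cvgr_gt (aff l x) (aff_continuous (l := l) (x := x))). Qed.

Lemma near_line (V : normedModType R) (p v : V) (S : set V) :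
  (\forall y \near p, S y) ->
  exists2 e : R, 0 < e & forall t : R, `|t| < e -> S (p + t *: v).
Proof.
move=> Sp.
have f_cont : (fun t : R^o => p + t *: v) @ (0 : R^o) --> p.
  rewrite -[X in _ --> X]addr0 -(scale0r v).
  by apply: cvgD; [exact: cvg_cst|apply: cvgZr_tmp; exact: cvg_id].
have := f_cont _ Sp; rewrite nbhs_simpl /= => /nbhs_ballP [e /= e0 He].
by exists e => // t te; apply: He; rewrite /ball /= sub0r normrN.
Qed.

(** A small step against the normal [l.1] stays in [S] and lowers [aff l] by a positive amount, so
    the value at [x] cannot be 0. *)
Lemma interior_aff_gt0 (S : set (pt2 R)) l x : l.1 != (0, 0) ->
  (forall y, S y -> 0 <= aff l y) -> S° x -> 0 < aff l x.
Proof.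
move=> l0 Sl Sx.
have [e e0 He] := near_line (l.1.1, l.1.2) Sx.
have := Sl _ (He (- (e / 2)) _); rewrite aff_move /= => H.
have {}H : 0 <= aff l x + - (e / 2) * (l.1.1 * l.1.1 + l.1.2 * l.1.2).
  by apply: H; rewrite normrN gtr0_norm; lra.
apply: lt_le_trans (_ : (e / 2) * (l.1.1 * l.1.1 + l.1.2 * l.1.2) <= _); last lra.
apply: mulr_gt0; first lra.
case: l l0 {Sl H He} => -[a b] c /=; rewrite xpair_eqE negb_and => /orP[] h.
  by rewrite ltr_pwDl // -expr2 ?exprn_even_gt0 ?sqr_ge0.
by rewrite ltr_wpDl // -expr2 ?exprn_even_gt0 ?sqr_ge0.
Qed.

Definition convex_in (V : lmodType R) (S : set V) :=
  forall (x y : V) (t : R), S x -> S y -> 0 <= t <= 1 -> S (x + t *: (y - x)).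

Lemma convex_connected (S : set (pt2 R)) : convex_in S -> connected S.
Proof.
move=> cS.
have [->|/set0P[x Sx]] := eqVneq S set0; first exact: connected0.
have -> : S = \bigcup_(y in S) ((fun t : R^o => x + t *: (y - x)) @` `[0, 1]).
  apply/seteqP; split=> [y Sy|z [y Sy] [t /= t01 <-]].
    exists y => //; exists 1; first by rewrite /= in_itv /= ler01 lexx.
    by rewrite scale1r addrC subrK.
  by apply: cS => //; rewrite in_itv in t01.
apply: bigcup_connected => [|y Sy].
  exists x => y Sy; exists 0; first by rewrite /= in_itv /= ler01 lexx.
  by rewrite scale0r addr0.
apply: connected_continuous_connected; first exact: segment_connected.
apply: continuous_subspaceT => t.
by apply: cvgD; [exact: cvg_cst|apply: cvgZr_tmp; exact: cvg_id].
Qed.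

(** By the intermediate value theorem the image of [S] is an interval that misses 0. This confines a
    component of the visible part to one side of a shadow boundary. *)
Lemma connected_aff_gt0 (S : set (pt2 R)) l x : connected S ->
  (forall y, S y -> aff l y != 0) -> S x -> 0 < aff l x ->
  forall y, S y -> 0 < aff l y.
Proof.
move=> cS nz Sx lx y Sy; rewrite ltNge; apply/negP => ly.
have : connected (aff l @` S : set R).
  apply: connected_continuous_connected => //.
  by apply: continuous_subspaceT => z; exact: aff_continuous.
move/connected_intervalP => /(_ (aff l y) (aff l x) _ _ 0)[].
- by exists y.
- by exists x.
- by rewrite ly ltW.
- by move=> z Sz z0; move: (nz z Sz); rewrite z0 eqxx.
Qed.

Lemma closure_aff_ge0 (S : set (pt2 R)) l q :
  (forall y, S y -> 0 < aff l y) -> closure S q -> 0 <= aff l q.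
Proof.
move=> Sl Sq; rewrite leNgt; apply/negP => lq.
pose l' : R * R * R := (- l.1.1, - l.1.2, - l.2).
have l'E y : aff l' y = - aff l y by rewrite /aff /=; ring.
have : \forall y \near q, 0 < aff l' y by apply: aff_gt0_near; rewrite l'E oppr_gt0.
move=> /Sq [y [/Sl Hy /=]]; rewrite l'E oppr_gt0 => /lt_trans /(_ Hy).
by rewrite ltxx.
Qed.

Definition ldet (l m : R * R * R) : R := l.1.1 * m.1.2 - l.1.2 * m.1.1.

Definition meet_point (l m : R * R * R) : pt2 R :=
  ((l.1.2 * m.2 - l.2 * m.1.2) / ldet l m, (l.2 * m.1.1 - l.1.1 * m.2) / ldet l m).

Lemma meet_pointP l m q : ldet l m != 0 -> aff l q = 0 -> aff m q = 0 ->
  q = meet_point l m.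
Proof.
case: l m q => [[a b] c] [[a' b'] c'] [q1 q2]; rewrite /ldet !affE /= => D H H'.
have E : c = - (a * q1 + b * q2) by move/eqP: H; rewrite addrC addr_eq0 => /eqP.
have E' : c' = - (a' * q1 + b' * q2) by move/eqP: H'; rewrite addrC addr_eq0 => /eqP.
rewrite /meet_point /ldet /= E E'.
by congr pair; apply: (mulIf D); rewrite mulfVK //; ring.
Qed.

(** If no two boundary lines cross at [q], then all those through [q] are parallel, hence equal, and
    [x0] lies on the positive side of each. They all bound the same half-plane, which is [C] near
    [q]. *)
Lemma polygon_vertex_meet (I : finType) (ls : I -> R * R * R) (C : set (pt2 R)) q :
  C !=set0 -> (forall x, C x <-> forall i, 0 < aff (ls i) x) ->
  polygon_vertex C q -> exists i j, q = meet_point (ls i) (ls j).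
Proof.
move=> [x0 Cx0] CE [clq nCq nh]; apply: contrapT => nex; apply: nh.
have ge0 i : 0 <= aff (ls i) q.
  by apply: closure_aff_ge0 clq => y /CE.
have [i qi] : exists i, aff (ls i) q = 0.
  apply: contrapT => H; apply: nCq; apply/CE => i.
  by rewrite lt_neqAle ge0 andbT eq_sym; apply/eqP => qi; apply: H; exists i.
(* For a line through [q] this is its form at [x0], hence positive; it fixes the sign of the factor
   between two parallel forms. *)
pose g j : R := (ls j).1.1 * (x0.1 - q.1) + (ls j).1.2 * (x0.2 - q.2).
have gE j : aff (ls j) q = 0 -> 0 < g j.
  move=> qj; have : 0 < aff (ls j) x0 by move/CE : Cx0.
  suff -> : aff (ls j) x0 = g j + aff (ls j) q by rewrite qj addr0.
  by rewrite /aff /g; ring.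
have par j : aff (ls j) q = 0 ->
    forall y, g i * aff (ls j) y = g j * aff (ls i) y.
  move=> qj y.
  have D : ldet (ls i) (ls j) = 0.
    apply/eqP; apply: contrapT => /negP D; apply: nex; exists i, j.
    exact: meet_pointP.
  have yE l : aff l q = 0 -> aff l y = l.1.1 * (y.1 - q.1) + l.1.2 * (y.2 - q.2).
    by move=> lq; rewrite -[LHS]subr0 -lq /aff; ring.
  rewrite !yE // /g; apply/eqP; rewrite -subr_eq0; apply/eqP.
  rewrite -[RHS](mulr0 ((x0.1 - q.1) * (y.2 - q.2) - (x0.2 - q.2) * (y.1 - q.1))).
  by rewrite -D /ldet; ring.
exists (ls i).1.1, (ls i).1.2.
have : \forall y \near q, forall j, aff (ls j) q = 0 \/ 0 < aff (ls j) y.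
  apply: (@filter_forall _ I (fun j y => aff (ls j) q = 0 \/ 0 < aff (ls j) y)
    (nbhs q) (nbhs_filter q)) => j.
  have := ge0 j; rewrite le_eqVlt => /orP[/eqP <-|/aff_gt0_near].
    by apply: filterE => y; left.
  by apply: filterS => y; right.
apply: filterS => y Hy.
have -> : (ls i).1.1 * (y.1 - q.1) + (ls i).1.2 * (y.2 - q.2) = aff (ls i) y.
  by rewrite -[RHS]subr0 -[in RHS]qi /aff; ring.
split=> [/CE //|yi]; apply/CE => j.
case: (Hy j) => // qj.
by rewrite -(pmulr_rgt0 _ (gE _ qi)) par // mulr_gt0 // gE.
Qed.

(** [u] runs along the first line and [v] along the second, so small steps from [q] along either, in
    both senses, avoid [C]. If a half-plane agreed with [C] near [q], its form would vanish on [u]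
    and [v], although [u + v] points into [C]. *)
Lemma polygon_vertex_corner (C : set (pt2 R)) l m q (u v : pt2 R) :
  (\forall x \near q, C x <-> 0 < aff l x /\ 0 < aff m x) ->
  aff l q = 0 -> aff m q = 0 ->
  l.1.1 * u.1 + l.1.2 * u.2 = 0 -> 0 < m.1.1 * u.1 + m.1.2 * u.2 ->
  0 < l.1.1 * v.1 + l.1.2 * v.2 -> m.1.1 * v.1 + m.1.2 * v.2 = 0 ->
  polygon_vertex C q.
Proof.
move=> Cq lq mq lu mu lv mv.
have luv : 0 < l.1.1 * (u + v).1 + l.1.2 * (u + v).2.
  by move: lu lv; case: (u) (v) => a b [c d]; rewrite pairD /=; lra.
have muv : 0 < m.1.1 * (u + v).1 + m.1.2 * (u + v).2.
  by move: mu mv; case: (u) (v) => a b [c d]; rewrite pairD /=; lra.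
have inC (B : set (pt2 R)) : (\forall x \near q, B x) ->
    exists2 t : R, 0 < t & B (q + t *: (u + v)) /\ C (q + t *: (u + v)).
  move=> Bq; have [e e0 He] := near_line (u + v) (filterI Bq Cq).
  exists (e / 2); first lra.
  have [|? H] := He (e / 2); first by rewrite gtr0_norm; lra.
  by split => //; apply/H; rewrite !aff_move lq mq !add0r !mulr_gt0 //; lra.
split.
- by move=> B /inC [t t0 [? ?]]; exists (q + t *: (u + v)).
- by move/(nbhs_singleton Cq).1; rewrite lq ltxx => -[].
move=> [a [b ab]].
have neg (w : pt2 R) : (forall t, ~ (0 < aff l (q + t *: w) /\ 0 < aff m (q + t *: w))) ->
    a * w.1 + b * w.2 = 0.
  move=> wN; have [e e0 He] := near_line w (filterI ab Cq).
  have H t : `|t| < e -> t * (a * w.1 + b * w.2) <= 0.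
    move=> /He [H1 H2]; rewrite leNgt; apply/negP => H; apply: (wN t); apply/H2/H1.
    by rewrite slope_move.
  have := H (e / 2); have := H (- (e / 2)).
  rewrite normrN gtr0_norm ?divr_gt0 //.
  have e2 : e / 2 < e by lra.
  move=> /(_ e2) h1 /(_ e2) h2; apply: (@mulfI _ (e / 2)); lra.
have ua := neg u; have va := neg v.
have [t t0 [/= H1 H2]] := inC _ ab.
have := H1.1 H2.
have -> : a * ((q + t *: (u + v)).1 - q.1) + b * ((q + t *: (u + v)).2 - q.2) =
    t * ((a * u.1 + b * u.2) + (a * v.1 + b * v.2)).
  by rewrite slope_move; case: (u) (v) => ? ? [? ?]; rewrite !ptE /=; ring.
rewrite ua ?va; first by rewrite addr0 mulr0 ltxx.
  by move=> s; rewrite !aff_move mq mv lq mulr0 addr0 ltxx => -[].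
by move=> s; rewrite !aff_move lq lu mq mulr0 addr0 ltxx => -[].
Qed.

End Planar.

(** * Convex hulls, triangles and barycentric coordinates *)

Section Hull.
Variables (R : realType) (V : lmodType R) (n : nat).
Implicit Types (pos : 'I_n -> V) (s : {set 'I_n}).

(** Weights defined on all vertices and zero outside [s] allow points of two different hulls to be
    compared weight by weight. *)
Lemma hullE pos s q : hull pos s q <-> exists a : 'I_n -> R,
  [/\ forall i, 0 <= a i, forall i, i \notin s -> a i = 0,
      \sum_i a i = 1 & q = \sum_i a i *: pos i].
Proof.
split=> [[a [a0 a1 ->]]|[a [a0 as0 a1 ->]]].
  exists (fun i => if i \in s then a i else 0); split.
  - by move=> i; case: ifP.
  - by move=> i /negbTE ->.
  - by rewrite -big_mkcond.
  - by rewrite big_mkcond; apply: eq_bigr => i _; case: ifP => // _; rewrite scale0r.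
exists a; split => //.
  by rewrite big_mkcond -[RHS]a1; apply: eq_bigr => i _; case: ifPn => // /as0 ->.
by rewrite [RHS]big_mkcond; apply: eq_bigr => i _; case: ifPn => // /as0 ->; rewrite scale0r.
Qed.

Lemma hull3P pos (a b c : 'I_n) q : a != b -> a != c -> b != c ->
  hull pos [set a; b; c]%SET q <-> exists x y z : R,
  [/\ 0 <= x, 0 <= y, 0 <= z, x + y + z = 1 &
      q = x *: pos a + y *: pos b + z *: pos c].
Proof.
move=> ab ac bc.
have sumE (W : nmodType) (F : 'I_n -> W) :
    \sum_(i in [set a; b; c]%SET) F i = F a + F b + F c.
  rewrite -finset.setUA big_setU1 ?big_setU1 ?big_set1 /= ?addrA // !inE //.
  by rewrite negb_or ab ac.
split=> [[u [u0 u1 ->]]|[x [y [z [x0 y0 z0 xyz ->]]]]].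
  by exists (u a), (u b), (u c); move: u1; rewrite !sumE; split.
exists (fun i => if i == a then x else if i == b then y else z).
rewrite !sumE !eqxx; rewrite [b == a]eq_sym [c == a]eq_sym [c == b]eq_sym.
rewrite (negbTE ab) (negbTE ac) (negbTE bc); split=> // i.
by case: ifP => // _; case: ifP.
Qed.

End Hull.

Section Triangles.
Variable R : realType.
Implicit Types (A B C q : pt2 R).

Definition line A B : R * R * R :=
  (A.2 - B.2, B.1 - A.1, A.1 * B.2 - B.1 * A.2).

Lemma aff_line A B q : aff (line A B) q = signed_area A B q.
Proof. by rewrite /aff /line /signed_area /=; ring. Qed.

Lemma sum_fst (S T : nmodType) (I : finType) (F : I -> (S * T)%type) :
  (\sum_i F i).1 = \sum_i (F i).1.
Proof. by apply: (big_morph fst). Qed.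

Lemma sum_snd (S T : nmodType) (I : finType) (F : I -> (S * T)%type) :
  (\sum_i F i).2 = \sum_i (F i).2.
Proof. by apply: (big_morph snd). Qed.

Lemma aff_sum (I : finType) (l : R * R * R) (a : I -> R) (p : I -> pt2 R) :
  \sum_i a i = 1 -> aff l (\sum_i a i *: p i) = \sum_i a i * aff l (p i).
Proof.
move=> a1; rewrite /aff sum_fst sum_snd -[X in _ + X](mul1r l.2) -a1.
rewrite !mulr_sumr mulr_suml -!big_split /=; apply: eq_bigr => i _.
by elim/pt2_ind: (p i) => u v; rewrite /GRing.scale /=; ring.
Qed.

(* A common point lies on the separating line, so only u and v can have a nonzero
   weight, and these two weights are determined by the point. *)
Lemma hull_sep n (pos : 'I_n -> pt2 R) (f g : {set 'I_n}) u v :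
  pos u != pos v ->
  (forall i, i \in f -> i = u \/ i = v \/ signed_area (pos u) (pos v) (pos i) < 0) ->
  (forall i, i \in g -> i = u \/ i = v \/ 0 < signed_area (pos u) (pos v) (pos i)) ->
  hull pos f `&` hull pos g = hull pos (f :&: g)%SET.
Proof.
move=> uv Hf Hg; apply/seteqP; split=> q; last first.
  move=> /hullE[a [a0 as0 a1 ->]].
  by split; apply/hullE; exists a; split => // i Hi; apply: as0;
     rewrite inE (negbTE Hi) ?andbF.
move=> [/hullE[a [a0 as0 a1 qa]] /hullE[b [b0 bs0 b1 qb]]].
pose l := line (pos u) (pos v).
have lu : aff l (pos u) = 0 by rewrite aff_line /signed_area; ring.
have lv : aff l (pos v) = 0 by rewrite aff_line /signed_area; ring.
have la i : a i * aff l (pos i) <= 0.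
  have [fi|/as0 ->] := boolP (i \in f); last by rewrite mul0r.
  case: (Hf i fi) => [->|[->|]]; rewrite ?lu ?lv ?mulr0 // -aff_line => /ltW.
  exact: mulr_ge0_le0.
have lb i : 0 <= b i * aff l (pos i).
  have [gi|/bs0 ->] := boolP (i \in g); last by rewrite mul0r.
  case: (Hg i gi) => [->|[->|]]; rewrite ?lu ?lv ?mulr0 // -aff_line => /ltW.
  exact: mulr_ge0.
have lq : aff l q = 0.
  apply/eqP; rewrite eq_le; apply/andP; split.
    by rewrite qa aff_sum //; apply: sumr_le0 => i _.
  by rewrite qb aff_sum //; apply: sumr_ge0 => i _.
have a_uv i : i != u -> i != v -> a i = 0.
  move=> iu iv; have [fi|/as0 -> //] := boolP (i \in f).
  have : a i * aff l (pos i) == 0.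
    move: lq; rewrite qa aff_sum // => /eqP.
    rewrite -oppr_eq0 -sumrN psumr_eq0; last by move=> j _; rewrite oppr_ge0.
    by move=> /allP /(_ i (mem_index_enum _)); rewrite /= oppr_eq0.
  rewrite mulf_eq0 => /orP[/eqP //|].
  case: (Hf i fi) => [E|[E|]]; [by rewrite E eqxx in iu|by rewrite E eqxx in iv|].
  by rewrite -aff_line => /lt_eqF ->.
have b_uv i : i != u -> i != v -> b i = 0.
  move=> iu iv; have [gi|/bs0 -> //] := boolP (i \in g).
  have : b i * aff l (pos i) == 0.
    move: lq; rewrite qb aff_sum // => /eqP.
    rewrite psumr_eq0; last by move=> j _.
    by move=> /allP /(_ i (mem_index_enum _)).
  rewrite mulf_eq0 => /orP[/eqP //|].
  case: (Hg i gi) => [E|[E|]]; [by rewrite E eqxx in iu|by rewrite E eqxx in iv|].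
  by rewrite -aff_line => /gt_eqF ->.
have vu : v != u by apply: contraNneq uv => ->.
have sum2 (W : nmodType) (F : 'I_n -> W) :
    (forall i, i != u -> i != v -> F i = 0) -> \sum_i F i = F u + F v.
  move=> H; rewrite (bigD1 u) //= (bigD1 v) //= big1 ?addr0 //.
  by move=> i /andP[]; exact: H.
have ab_u : a u = b u.
  move: a1 b1; rewrite !sum2 // => a1 b1.
  have := qa; rewrite qb !sum2; try by move=> i iu iv; rewrite ?a_uv ?b_uv ?scale0r.
  have -> : a v = 1 - a u by lra.
  have -> : b v = 1 - b u by lra.
  move=> /eqP; rewrite -subr_eq0.
  have -> : b u *: pos u + (1 - b u) *: pos v - (a u *: pos u + (1 - a u) *: pos v)
     = (b u - a u) *: (pos u - pos v).
    elim/pt2_ind: (pos u) => ? ?; elim/pt2_ind: (pos v) => ? ?.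
    by rewrite !ptE /GRing.scale /=; congr pair; ring.
  by rewrite scaler_eq0 !subr_eq0 (negbTE uv) orbF => /eqP.
have ab i : a i = b i.
  have [-> //|iu] := eqVneq i u.
  have [->|iv] := eqVneq i v; last by rewrite a_uv // b_uv.
  by move: a1 b1; rewrite !sum2 // ab_u => <- /addrI.
apply/hullE; exists a; split=> // i; rewrite inE negb_and => /orP[/as0 //|/bs0].
by rewrite ab.
Qed.

Definition triangle A B C : set (pt2 R) := [set q | exists x y z : R,
  [/\ 0 <= x, 0 <= y, 0 <= z, x + y + z = 1 & q = x *: A + y *: B + z *: C]].

Definition bary A B C q : R := signed_area B C q / signed_area A B C.

Lemma area_rot A B C : signed_area B C A = signed_area A B C.
Proof. by rewrite /signed_area; ring. Qed.

Lemma area_swap A B C : signed_area B A C = - signed_area A B C.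
Proof. by rewrite /signed_area; ring. Qed.

Lemma area_comb A B P Q S (x y z : R) : x + y + z = 1 ->
  signed_area A B (x *: P + y *: Q + z *: S) =
  x * signed_area A B P + y * signed_area A B Q + z * signed_area A B S.
Proof.
move=> E; have -> : x = 1 - y - z by lra.
elim/pt2_ind: A => ? ?; elim/pt2_ind: B => ? ?; elim/pt2_ind: P => ? ?.
elim/pt2_ind: Q => ? ?; elim/pt2_ind: S => ? ?.
by rewrite !ptE /signed_area /=; ring.
Qed.

Lemma area_refl A B : (signed_area A B A = 0) * (signed_area A B B = 0).
Proof. by rewrite /signed_area; split; ring. Qed.

Lemma bary_comb A B C (x y z : R) : signed_area A B C != 0 -> x + y + z = 1 ->
  bary A B C (x *: A + y *: B + z *: C) = x.
Proof.
move=> D E; rewrite /bary area_comb // !area_refl area_rot !mulr0 !addr0.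
by rewrite mulfK.
Qed.

Lemma bary_decomp A B C q : signed_area A B C != 0 ->
  bary A B C q + bary B C A q + bary C A B q = 1 /\
  q = bary A B C q *: A + bary B C A q *: B + bary C A B q *: C.
Proof.
rewrite /bary -(area_rot A B C) -(area_rot B C A) => D.
split.
  by rewrite -!mulrDl; apply: (mulIf D); rewrite mulfVK // mul1r /signed_area; ring.
move: D; elim/pt2_ind: A => a1 a2; elim/pt2_ind: B => b1 b2.
elim/pt2_ind: C => c1 c2; elim/pt2_ind: q => q1 q2; rewrite !ptE /= => D.
by congr pair; field.
Qed.

Lemma triangleP A B C q : signed_area A B C != 0 ->
  triangle A B C q <->
  [/\ 0 <= bary A B C q, 0 <= bary B C A q & 0 <= bary C A B q].
Proof.
move=> D; have D1 : signed_area B C A != 0 by rewrite area_rot.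
have D2 : signed_area C A B != 0 by rewrite area_rot.
split; last first.
  move=> [x0 y0 z0]; have [E qE] := bary_decomp q D.
  by exists (bary A B C q), (bary B C A q), (bary C A B q).
move=> [x [y [z [x0 y0 z0 E ->]]]]; split.
- by rewrite bary_comb.
- by rewrite -addrA addrC bary_comb ?D1 //; lra.
- by rewrite addrC addrA bary_comb ?D2 //; lra.
Qed.

Definition bary_line A B C : R * R * R := let D := signed_area A B C in
  ((line B C).1.1 / D, (line B C).1.2 / D, (line B C).2 / D).

Lemma aff_bary_line A B C q : aff (bary_line A B C) q = bary A B C q.
Proof. by rewrite /bary -aff_line /aff /=; ring. Qed.

Lemma bary_line_neq0 A B C : signed_area A B C != 0 -> (bary_line A B C).1 != (0, 0).
Proof.
move=> D; apply/eqP => -[/eqP + /eqP]; rewrite !mulf_eq0 !invr_eq0 (negbTE D) !orbF.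
move=> /eqP h1 /eqP h2; move/eqP: D; apply.
by rewrite /signed_area (subr0_eq h1) (subr0_eq h2); ring.
Qed.

Lemma interior_triangleP A B C q : signed_area A B C != 0 ->
  (triangle A B C)° q <->
  [/\ 0 < bary A B C q, 0 < bary B C A q & 0 < bary C A B q].
Proof.
move=> D; have D1 : signed_area B C A != 0 by rewrite area_rot.
have D2 : signed_area C A B != 0 by rewrite area_rot.
split.
  move=> qi; split; rewrite -aff_bary_line; apply: interior_aff_gt0 qi;
    rewrite ?bary_line_neq0 // => y /(triangleP y D)[]; rewrite aff_bary_line //.
rewrite -!aff_bary_line => -[/aff_gt0_near x0 /aff_gt0_near y0 /aff_gt0_near z0].
apply: (filterS _ (filterI x0 (filterI y0 z0))) => y /= [x1 [y1 z1]].
by apply/triangleP => //; split; rewrite -aff_bary_line ltW.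
Qed.

Lemma sum_set3 (n : nat) (W : nmodType) (a b c : 'I_n) (G : 'I_n -> W) :
  a != b -> a != c -> b != c ->
  (forall i, i \notin [set a; b; c]%SET -> G i = 0) ->
  \sum_i G i = G a + G b + G c.
Proof.
move=> ab ac bc H; rewrite (bigD1 a) //= (bigD1 b) /=; last by rewrite eq_sym.
rewrite (bigD1 c) /=; last by rewrite ![c == _]eq_sym ac bc.
rewrite big1 ?addr0 ?addrA // => i /andP[/andP[i1 i2] i3]; apply: H.
by rewrite !inE !negb_or i1 i2.
Qed.

Lemma bary_uniq (n : nat) (p : 'I_n -> pt2 R) (a b c : 'I_n) (u w : 'I_n -> R) :
  a != b -> a != c -> b != c -> signed_area (p a) (p b) (p c) != 0 ->
  (forall i, i \notin [set a; b; c]%SET -> u i = 0) ->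
  (forall i, i \notin [set a; b; c]%SET -> w i = 0) ->
  \sum_i u i = 1 -> \sum_i w i = 1 ->
  \sum_i u i *: p i = \sum_i w i *: p i -> u =1 w.
Proof.
move=> ab ac bc D us ws u1 w1 E i.
have key (v : 'I_n -> R) : (forall i, i \notin [set a; b; c]%SET -> v i = 0) ->
    \sum_i v i = 1 ->
    v a = bary (p a) (p b) (p c) (\sum_i v i *: p i) /\
    v b = bary (p b) (p c) (p a) (\sum_i v i *: p i).
  move=> vs v1; have v1' : v a + v b + v c = 1 by rewrite -sum_set3.
  have -> : \sum_i v i *: p i = v a *: p a + v b *: p b + v c *: p c.
    by rewrite (@sum_set3 _ _ a b c) // => j /vs ->; rewrite scale0r.
  move: (p a) (p b) (p c) D => x y z D; split; first by rewrite bary_comb.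
  have D1 : signed_area y z x != 0 by rewrite area_rot.
  rewrite -addrA addrC bary_comb // -v1'; ring.
have [ua ub] := key u us u1; have [wa wb] := key w ws w1.
have uwa : u a = w a by rewrite ua wa E.
have uwb : u b = w b by rewrite ub wb E.
have [iF|iF] := boolP (i \in [set a; b; c]%SET); last by rewrite us // ws.
move: iF; rewrite !inE => /orP[/orP[]|] /eqP -> //.
move: u1 w1; rewrite !(@sum_set3 _ _ a b c) // uwa uwb => <-.
by move/addrI.
Qed.

End Triangles.

(** * Cardinalities and a discrete sign change *)

Lemma card_finType (X : finType) : ([set: X] #= `I_#|X|)%card.
Proof.
have <- : (fun x : X => nat_of_ord (enum_rank x)) @` [set: X] = `I_#|X|.
  apply/seteqP; split=> [_ [x _ <-] //=|m /= mX].
  by exists (enum_val (Ordinal mX)) => //; rewrite enum_valK.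
rewrite card_eq_sym; apply: inj_card_eq => x y _ _ /val_inj.
exact: enum_rank_inj.
Qed.

Lemma card_le_range (X : finType) (Y : Type) (S : set Y) (f : X -> Y) m :
  S `<=` range f -> (S #= `I_m)%card -> (m <= #|X|)%N.
Proof.
move=> /subset_card_le Sf Sm.
have h : (S #<= `I_#|X|)%card.
  apply: card_le_trans Sf (card_le_trans (card_image_le _ _) _).
  by have := card_finType X; rewrite card_eq_le => /andP[].
rewrite -card_le_II; apply: card_le_trans h.
by move: Sm; rewrite card_eq_le => /andP[].
Qed.

Lemma card_ge_range (X : finType) (Y : Type) (S : set Y) (f : X -> Y) m :
  injective f -> range f `<=` S -> (S #= `I_m)%card -> (#|X| <= m)%N.
Proof.
move=> injf /subset_card_le fS Sm.
have h : (`I_#|X| #<= S)%card.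
  apply: card_le_trans fS; apply: (@card_le_trans _ _ _ [set: X]).
    by have := card_finType X; rewrite card_eq_le => /andP[].
  have : (range f #= [set: X])%card by apply: inj_card_eq => x y _ _; exact: injf.
  by rewrite card_eq_le => /andP[].
rewrite -card_le_II; apply: card_le_trans h _.
by move: Sm; rewrite card_eq_le => /andP[].
Qed.

(** A discrete intermediate value theorem. Applied to the rays from the origin, or to the diagonals
    of the fan, it locates the sector or the fan triangle of a given point. *)
Lemma sign_change (R : realType) (F : nat -> R) a b : (a < b)%N ->
  0 <= F a -> F b <= 0 ->
  exists i, [/\ (a <= i)%N, (i < b)%N, 0 <= F i & F i.+1 <= 0].
Proof.
move=> ab Fa; elim: b ab => // b IH; rewrite ltnS leq_eqVlt => /orP[/eqP <-|ab] Fb.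
  by exists a.
have [/(IH ab)[i [? ? ? ?]]|Fb'] := leP (F b) 0; last by exists b; rewrite ltnW // ltW.
by exists i; split => //; apply: ltnW.
Qed.

Lemma area_swapr (R : realType) (A B C : pt2 R) :
  signed_area A C B = - signed_area A B C.
Proof. by rewrite /signed_area; ring. Qed.

(** * The terrain *)

Section Curve.
Variables (R : realType) (L : nat).
Implicit Types (x : pt2 R).

(* A parabola with vertices in convex position: it is convex towards the origin,
   so it is seen monotonically both from the origin and from its point j = 0. *)
Definition curve (j : nat) : pt2 R := (j%:R, (L%:R - j%:R) ^+ 2).

(** The centroid of 0, [curve j] and [curve j.+1]: the third corner is the origin and adds nothing
    to the sum. *)
Definition centroid (j : nat) : pt2 R := 3^-1 *: (curve j + curve j.+1).

Lemma area_curve a b c : signed_area (curve a) (curve b) (curve c) =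
  (b%:R - a%:R) * (c%:R - a%:R) * (c%:R - b%:R) :> R.
Proof. by rewrite /signed_area /=; ring. Qed.

(* Positive on the side of the ray from 0 through curve j where the curve points
   of larger index lie. *)
Definition ray (j : nat) : R * R * R := line (curve j) 0.

Lemma ray_curve j i :
  aff (ray j) (curve i) = (i%:R - j%:R) * (L%:R ^+ 2 - i%:R * j%:R).
Proof. by rewrite /ray /aff /=; ring. Qed.

Lemma aff_ray0 j : aff (ray j) 0 = 0.
Proof. by rewrite /ray /aff /=; ring. Qed.

Lemma affZ_ray j (t : R) x : aff (ray j) (t *: x) = t * aff (ray j) x.
Proof.
elim/pt2_ind: x => a b; rewrite !ptE /ray /= .
by rewrite subr0 sub0r !(mulr0, mul0r, subrr, addr0); ring.
Qed.

Lemma affD_ray j x y : aff (ray j) (x + y) = aff (ray j) x + aff (ray j) y.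
Proof.
elim/pt2_ind: x => a b; elim/pt2_ind: y => c d; rewrite !ptE /ray /= .
by rewrite !(mulr0, mul0r, subrr, addr0); ring.
Qed.

Lemma aff_centroid l j :
  aff l (centroid j) = (aff l 0 + aff l (curve j) + aff l (curve j.+1)) / 3.
Proof. by rewrite /centroid /curve !ptE /aff /GRing.scale /=; field. Qed.

Lemma area_centroid A B j : signed_area A B (centroid j) =
  (signed_area A B 0 + signed_area A B (curve j) + signed_area A B (curve j.+1)) / 3.
Proof. by rewrite -!aff_line aff_centroid. Qed.

(** The centroid cuts the sector into three triangles of equal signed area, so the faces of a
    pyramid inherit the orientation of their sector. *)
Lemma area_centroidE j : let a := signed_area 0 (curve j) (curve j.+1) / 3 in
  [/\ signed_area 0 (curve j) (centroid j) = a,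
      signed_area 0 (centroid j) (curve j.+1) = a &
      signed_area (centroid j) (curve j) (curve j.+1) = a].
Proof.
split.
- by rewrite area_centroid !area_refl !add0r.
- rewrite -(area_rot 0) -(area_rot (centroid j)) area_centroid !area_refl.
  by rewrite addr0 add0r area_rot area_rot.
- rewrite -(area_rot (centroid j)) area_centroid !area_refl !addr0.
  by rewrite (area_rot 0).
Qed.

(** By [ray_curve], this factor decides on which side of the ray through one curve point another one
    lies; its positivity makes the angular order around 0 that of the indices. *)
Lemma lt_sqrL i j : (i < j)%N -> (j <= L)%N -> 0 < L%:R ^+ 2 - i%:R * j%:R :> R.
Proof.
move=> ij jL; have : i%:R + 1 <= j%:R :> R by rewrite natr1 ler_nat.
have : j%:R <= L%:R :> R by rewrite ler_nat.
have : 0 <= i%:R :> R by [].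
rewrite expr2; nra.
Qed.

Lemma ray_curve_gt0 j i : (j < i)%N -> (i <= L)%N -> 0 < aff (ray j) (curve i).
Proof.
move=> ji iL; rewrite ray_curve mulr_gt0 //; first by rewrite subr_gt0 ltr_nat.
by rewrite [i%:R * _]mulrC lt_sqrL.
Qed.

Lemma ray_curve_lt0 j i : (i < j)%N -> (j <= L)%N -> aff (ray j) (curve i) < 0.
Proof.
by move=> ji iL; rewrite ray_curve nmulr_rlt0 ?lt_sqrL // subr_lt0 ltr_nat.
Qed.

Lemma ray_curve_eq0 j : aff (ray j) (curve j) = 0.
Proof. by rewrite ray_curve subrr mul0r. Qed.

Lemma area_origin j : signed_area 0 (curve j) (curve j.+1) =
  - (L%:R ^+ 2 - j%:R * j.+1%:R) :> R.
Proof. by rewrite /signed_area /= -natr1; ring. Qed.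

Lemma area_origin_lt0 j : (j < L)%N -> signed_area 0 (curve j) (curve j.+1) < 0 :> R.
Proof. by move=> jL; rewrite area_origin oppr_lt0 lt_sqrL. Qed.

(** No integer lies strictly between [j] and [j.+1], so the product of [m - j] and [m - j - 1] is
    never negative. Thus all curve points lie on one side of each chord, while for [j < L] the
    origin lies on the other. *)
Lemma area_chord_ge0 j m : 0 <= signed_area (curve j) (curve j.+1) (curve m) :> R.
Proof.
rewrite area_curve -natr1; have [mj|jm] := leqP m j.
  have : m%:R <= j%:R :> R by rewrite ler_nat.
  nra.
have : j%:R + 1 <= m%:R :> R by rewrite natr1 ler_nat.
nra.
Qed.

Lemma area_chord_gt0 j m : m != j -> m != j.+1 ->
  0 < signed_area (curve j) (curve j.+1) (curve m) :> R.
Proof.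
move=> mj mj1; rewrite lt_neqAle area_chord_ge0 andbT eq_sym area_curve.
by rewrite !mulf_neq0 ?subr_eq0 ?eqr_nat // gtn_eqF.
Qed.

Lemma area_curve_gt0 a b c : (a < b)%N -> (b < c)%N ->
  0 < signed_area (curve a) (curve b) (curve c) :> R.
Proof.
move=> ab bc; have ac := ltn_trans ab bc.
by rewrite area_curve !mulr_gt0 // subr_gt0 ltr_nat.
Qed.

Lemma area_ray j x : signed_area 0 (curve j) x = - aff (ray j) x :> R.
Proof. by rewrite /ray aff_line area_swap. Qed.

End Curve.

Section Facets.
Variables (R : realType) (L k : nat).
Hypotheses (k_gt0 : (0 < k)%N) (kL : (k.*2 < L)%N).

Let n := (k + L.+1).+1.
Local Notation e := (curve R L).
Local Notation phi j := (aff (ray R L j)).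

Definition position (m : nat) : pt3 R :=
  if (m <= L)%N then (e m, 0)
  else if m == L.+1 then 0 else (centroid R L (m - L.+2).*2, 1).

Definition vertex (i : 'I_n) : pt3 R := position i.
Definition proj (i : 'I_n) : pt2 R := (vertex i).1.

Definition curve_vtx (j : nat) : 'I_n := inord j.
Definition origin_vtx : 'I_n := inord L.+1.
Definition apex_vtx (s : nat) : 'I_n := inord (L.+2 + s).

Local Notation E := curve_vtx.
Local Notation P0 := origin_vtx.
Local Notation A := apex_vtx.

Lemma val_E j : (j <= L)%N -> E j = j :> nat.
Proof. by move=> jL; rewrite inordK // ltnS (leq_trans jL) // (leq_trans (leqnSn L)) ?leq_addl. Qed.

Lemma val_P0 : P0 = L.+1 :> nat.
Proof. by rewrite inordK // ltnS leq_addl. Qed.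

Lemma val_A s : (s < k)%N -> A s = (L.+2 + s)%N :> nat.
Proof. by move=> sk; rewrite inordK //; lia. Qed.

Lemma vertex_E j : (j <= L)%N -> vertex (E j) = (e j, 0).
Proof. by move=> jL; rewrite /vertex /position val_E // jL. Qed.

Lemma vertex_P0 : vertex P0 = 0.
Proof. by rewrite /vertex /position val_P0 ltnn eqxx. Qed.

Lemma vertex_A s : (s < k)%N -> vertex (A s) = (centroid R L s.*2, 1).
Proof.
move=> sk; rewrite /vertex /position val_A // addKn.
by have [-> ->] : (L.+2 + s <= L = false /\ (L.+2 + s == L.+1) = false)%N by lia.
Qed.

Lemma vertexP (i : 'I_n) : [\/ exists2 j, (j <= L)%N & i = E j, i = P0 |
  exists2 s, (s < k)%N & i = A s].
Proof.
have [iL|Li] := leqP i L.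
  by constructor 1; exists i => //; apply: val_inj; rewrite /= val_E.
have [iL|iL] := eqVneq (i : nat) L.+1.
  by constructor 2; apply: val_inj; rewrite /= val_P0.
have sk : (i - L.+2 < k)%N by have := ltn_ord i; rewrite /n; lia.
constructor 3; exists (i - L.+2)%N => //; apply: val_inj; rewrite /= val_A //; lia.
Qed.

Lemma proj_E j : (j <= L)%N -> proj (E j) = e j.
Proof. by move=> jL; rewrite /proj vertex_E. Qed.

Lemma proj_P0 : proj P0 = 0.
Proof. by rewrite /proj vertex_P0. Qed.

Lemma proj_A s : (s < k)%N -> proj (A s) = centroid R L s.*2.
Proof. by move=> sk; rewrite /proj vertex_A. Qed.

(* Sector j is the triangle 0, e j, e j.+1; the sectors 2 s with s < k carry a
   pyramid with apex A s, made of FLeft, FRight (both facing the viewpoint 0) and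
   Far. The region beyond the curve is triangulated as a fan from e 0. *)
Inductive facet :=
  Back of nat | Flat of nat | FLeft of nat | FRight of nat | Far of nat.

Definition peak j := ~~ odd j && (j < k.*2)%N.

Definition valid F := match F with
  | Back i => (0 < i < L)%N
  | Flat j => (j < L)%N && ~~ peak j
  | FLeft s | FRight s | Far s => (s < k)%N
  end.

Definition corner1 F := match F with
  | Back _ => E 0 | Flat _ | FLeft _ | FRight _ => P0 | Far s => A s end.
Definition corner2 F := match F with
  | Back i => E i | Flat j => E j | FLeft s | Far s => E s.*2 | FRight s => A s end.
Definition corner3 F := match F with
  | Back i => E i.+1 | Flat j => E j.+1
  | FLeft s => A s | FRight s | Far s => E s.*2.+1 end.

Definition corners F : {set 'I_n} := [set corner1 F; corner2 F; corner3 F]%SET.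

Definition projs F := (proj (corner1 F), proj (corner2 F), proj (corner3 F)).

Lemma projsE F : valid F -> projs F = match F with
  | Back i => (e 0, e i, e i.+1)
  | Flat j => (0, e j, e j.+1)
  | FLeft s => (0, e s.*2, centroid R L s.*2)
  | FRight s => (0, centroid R L s.*2, e s.*2.+1)
  | Far s => (centroid R L s.*2, e s.*2, e s.*2.+1) end.
Proof.
by case: F => /= s sk; rewrite /projs /= ?proj_P0 ?proj_A ?proj_E //; lia.
Qed.

Lemma corners_neq F : valid F ->
  [/\ corner1 F != corner2 F, corner1 F != corner3 F & corner2 F != corner3 F].
Proof.
by case: F => /= s sk; split; apply/eqP => /(congr1 val) /=;
  rewrite ?val_P0 ?val_A ?val_E; lia.
Qed.

Definition facet_area F :=
  signed_area (proj (corner1 F)) (proj (corner2 F)) (proj (corner3 F)).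

Lemma facet_area_sign F : valid F ->
  if F is Back _ then 0 < facet_area F else facet_area F < 0.
Proof.
move=> vF; have := projsE vF; case: F vF => s /= sk []; rewrite /facet_area /= => -> -> ->.
- by apply: area_curve_gt0; lia.
- by apply: area_origin_lt0; lia.
- have [-> _ _] := area_centroidE R L s.*2; rewrite pmulr_llt0 // area_origin_lt0 //; lia.
- have [_ -> _] := area_centroidE R L s.*2; rewrite pmulr_llt0 // area_origin_lt0 //; lia.
- have [_ _ ->] := area_centroidE R L s.*2; rewrite pmulr_llt0 // area_origin_lt0 //; lia.
Qed.

Lemma facet_area_neq0 F : valid F -> facet_area F != 0.
Proof.
move=> vF; have := facet_area_sign vF.
by case: F vF => s _ => [/gt_eqF|/lt_eqF|/lt_eqF|/lt_eqF|/lt_eqF] ->.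
Qed.

Definition shape F := triangle (proj (corner1 F)) (proj (corner2 F)) (proj (corner3 F)).

Lemma hull_shape F q : valid F -> hull proj (corners F) q <-> shape F q.
Proof. by move=> /corners_neq[? ? ?]; exact: hull3P. Qed.

Definition sector F := match F with
  | Back _ => 0%N | Flat j => j | FLeft s | FRight s | Far s => s.*2 end.
Definition front F := if F is Back _ then false else true.

Lemma sector_lt F : valid F -> (sector F < L)%N.
Proof. by case: F => s /=; lia. Qed.

Lemma front_corner F i : valid F -> front F -> i \in corners F ->
  [\/ i = P0, i = E (sector F), i = E (sector F).+1 |
      i = A (sector F)./2 /\ proj i = centroid R L (sector F)].
Proof.
by case: F => // s sk _; rewrite /corners !inE /= => /orP[/orP[]|] /eqP ->;
  try (by constructor); constructor 4; rewrite doubleK proj_A.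
Qed.

(** * Two facets meet in a common face *)

Lemma meet_back i i' : (0 < i)%N -> (i < i')%N -> (i' < L)%N ->
  hull proj (corners (Back i)) `&` hull proj (corners (Back i')) =
  hull proj (corners (Back i) :&: corners (Back i'))%SET.
Proof.
(* The separating line is the diagonal of the fan that ends the triangle of smaller index. *)
move=> i0 ii iL; apply: (@hull_sep _ _ _ _ _ (E 0) (E i.+1)).
- rewrite !proj_E //; last lia.
  by apply/eqP => /(congr1 fst) /= /eqP; rewrite eqr_nat.
- move=> x; rewrite !inE /= => /orP[/orP[]|] /eqP ->; [by left| |by right; left].
  right; right; rewrite !proj_E; try lia.
  by rewrite area_swapr oppr_lt0 area_curve_gt0.
- move=> x; rewrite !inE /= => /orP[/orP[]|] /eqP ->; first by left.
    have [->|ne] := eqVneq i' i.+1; first by right; left.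
    by right; right; rewrite ?proj_E ?area_curve_gt0 //; lia.
  by right; right; rewrite ?proj_E ?area_curve_gt0 //; lia.
Qed.

Lemma meet_back_front i F : valid (Back i) -> valid F -> front F ->
  hull proj (corners F) `&` hull proj (corners (Back i)) =
  hull proj (corners F :&: corners (Back i))%SET.
Proof.
move=> /= iL vF fF; have jL := sector_lt vF.
(* The chord of the sector has the whole fan on its far side, because the curve is convex. *)
apply: (@hull_sep _ _ _ _ _ (E (sector F)) (E (sector F).+1)).
- rewrite !proj_E //; last lia.
  by apply/eqP => /(congr1 fst) /= /eqP; rewrite eqr_nat; lia.
- move=> x /(front_corner vF fF)[->|->|->|[_ xp]]; [|by left|by right; left|];
    right; right; rewrite ?proj_P0 ?proj_E ?xp //; try lia.
    by rewrite area_rot area_origin_lt0.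
  by rewrite area_centroid !area_refl !addr0 pmulr_llt0 // area_rot area_origin_lt0.
- have Hm m : (m <= L)%N -> E m = E (sector F) \/ E m = E (sector F).+1 \/
     0 < signed_area (proj (E (sector F))) (proj (E (sector F).+1)) (proj (E m)).
    move=> mL; have [->|m1] := eqVneq m (sector F); first by left.
    have [->|m2] := eqVneq m (sector F).+1; first by right; left.
    by right; right; rewrite ?proj_E ?area_chord_gt0 //; lia.
  by move=> x; rewrite !inE /= => /orP[/orP[]|] /eqP ->; apply: Hm; lia.
Qed.

Lemma meet_front F F' : valid F -> valid F' -> front F -> front F' ->
  (sector F < sector F')%N ->
  hull proj (corners F') `&` hull proj (corners F) =
  hull proj (corners F' :&: corners F)%SET.
Proof.
move=> vF vF' fF fF' FF; have jL := sector_lt vF; have jL' := sector_lt vF'.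
(* The ray that ends the lower sector separates the two facets. *)
apply: (@hull_sep _ _ _ _ _ P0 (E (sector F).+1)).
- rewrite ?proj_P0 ?proj_E //.
  by apply/eqP => /(congr1 fst) /= /eqP; rewrite eq_sym pnatr_eq0.
- have Hm m : (sector F < m <= L)%N -> 
      E m = E (sector F).+1 \/ aff (ray R L (sector F).+1) (e m) > 0.
    move=> mL; have [->|m1] := eqVneq m (sector F).+1; first by left.
    by right; rewrite ray_curve_gt0 //; lia.
  move=> x /(front_corner vF' fF')[->|->|->|[_ xp]]; first by left.
  + right; case: (Hm (sector F')) => [|->|]; [lia|by left|right].
    by rewrite ?proj_P0 ?proj_E ?area_ray ?oppr_lt0 //; lia.
  + right; case: (Hm (sector F').+1) => [|->|]; [lia|by left|right].
    by rewrite ?proj_P0 ?proj_E ?area_ray ?oppr_lt0 //; lia.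
  + right; right; rewrite ?proj_P0 ?proj_E ?area_ray ?oppr_lt0 ?xp //.
    have h1 : 0 < aff (ray R L (sector F).+1) (e (sector F').+1).
      by rewrite ray_curve_gt0 //; lia.
    suff h2 : 0 <= aff (ray R L (sector F).+1) (e (sector F')).
      by rewrite aff_centroid aff_ray0; lra.
    case: (Hm (sector F')) => [|[/(congr1 val)]|/ltW //]; rewrite /= ?val_E //;
      by [lia|move=> ->; rewrite ray_curve_eq0].
- have Hm m : (m <= sector F)%N -> aff (ray R L (sector F).+1) (e m) < 0.
    by move=> mL; rewrite ray_curve_lt0 //; lia.
  move=> x /(front_corner vF fF)[->|->|->|[_ xp]]; [by left| |by right; left|];
    right; right; rewrite ?proj_P0 ?proj_E ?area_ray ?oppr_gt0 ?xp //; try lia.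
    exact: Hm.
  by rewrite aff_centroid aff_ray0 ray_curve_eq0 addr0 add0r pmulr_llt0 // Hm.
Qed.

Lemma centroid_area_lt0 s : (s < k)%N ->
  let c := centroid R L s.*2 in
  [/\ signed_area 0 (e s.*2) c < 0, signed_area 0 c (e s.*2.+1) < 0 &
      signed_area c (e s.*2) (e s.*2.+1) < 0].
Proof.
move=> sk c; have [-> -> ->] := area_centroidE R L s.*2.
by rewrite pmulr_llt0 // area_origin_lt0 //; lia.
Qed.

Lemma area_lt0_neq (x y z : pt2 R) : signed_area x y z < 0 ->
  [/\ x != y, x != z & y != z].
Proof.
have z0 u v : (signed_area u u v = 0) * (signed_area u v u = 0) * (signed_area u v v = 0).
  by rewrite /signed_area; do !split; ring.
by move=> a; split; apply/eqP => xy; move: a; rewrite xy z0 ltxx.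
Qed.

Lemma meet_right_left s : (s < k)%N ->
  hull proj (corners (FRight s)) `&` hull proj (corners (FLeft s)) =
  hull proj (corners (FRight s) :&: corners (FLeft s))%SET.
Proof.
move=> sk; have [h1 h2 h3] := centroid_area_lt0 sk.
apply: (@hull_sep _ _ _ _ _ P0 (A s)); rewrite ?proj_P0 ?proj_A //.
- by have [] := area_lt0_neq h2.
- move=> x; rewrite !inE /= => /orP[/orP[]|] /eqP ->; [by left|by right; left|].
  by right; right; rewrite proj_E //; lia.
- move=> x; rewrite !inE /= => /orP[/orP[]|] /eqP ->; [by left| |by right; left].
  by right; right; rewrite proj_E ; [rewrite area_swapr oppr_gt0|lia].
Qed.

Lemma meet_left_far s : (s < k)%N ->
  hull proj (corners (FLeft s)) `&` hull proj (corners (Far s)) =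
  hull proj (corners (FLeft s) :&: corners (Far s))%SET.
Proof.
move=> sk; have [h1 h2 h3] := centroid_area_lt0 sk.
apply: (@hull_sep _ _ _ _ _ (E s.*2) (A s)); rewrite ?proj_A ?proj_E; try lia.
- by have [] := area_lt0_neq h1.
- move=> x; rewrite !inE /= => /orP[/orP[]|] /eqP ->; [|by left|by right; left].
  by right; right; rewrite proj_P0 area_rot.
- move=> x; rewrite !inE /= => /orP[/orP[]|] /eqP ->; [by right; left|by left|].
  by right; right; rewrite proj_E; [rewrite area_swap oppr_gt0|lia].
Qed.

Lemma meet_far_right s : (s < k)%N ->
  hull proj (corners (Far s)) `&` hull proj (corners (FRight s)) =
  hull proj (corners (Far s) :&: corners (FRight s))%SET.
Proof.
move=> sk; have [h1 h2 h3] := centroid_area_lt0 sk.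
apply: (@hull_sep _ _ _ _ _ (E s.*2.+1) (A s)); rewrite ?proj_A ?proj_E; try lia.
- by rewrite eq_sym; have [] := area_lt0_neq h2.
- move=> x; rewrite !inE /= => /orP[/orP[]|] /eqP ->; [by right; left| |by left].
  by right; right; rewrite proj_E; [rewrite -area_rot|lia].
- move=> x; rewrite !inE /= => /orP[/orP[]|] /eqP ->; [|by right; left|by left].
  by right; right; rewrite proj_P0 area_rot area_swapr oppr_gt0.
Qed.

Lemma facets_meet F F' : valid F -> valid F' ->
  hull proj (corners F) `&` hull proj (corners F') =
  hull proj (corners F :&: corners F')%SET.
Proof.
move=> vF vF'; have sym G G' :
    hull proj (corners G') `&` hull proj (corners G) =
    hull proj (corners G' :&: corners G)%SET ->
    hull proj (corners G) `&` hull proj (corners G') =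
    hull proj (corners G :&: corners G')%SET.
  by rewrite setIC finset.setIC.
have refl G : hull proj (corners G) `&` hull proj (corners G) =
    hull proj (corners G :&: corners G)%SET by rewrite setIid finset.setIid.
have [fF|bF] := boolP (front F); have [fF'|bF'] := boolP (front F'); last first.
- case: F F' vF vF' bF bF' => // i [] // i' /= vi vi' _ _.
  case: (ltngtP i i') => [ii|ii|<- //]; last by apply: sym; apply: meet_back; lia.
  by apply: meet_back; lia.
- by case: F vF bF => // i vi _; apply: sym; exact: meet_back_front.
- by case: F' vF' bF' => // i vi _; exact: meet_back_front.
case: (ltngtP (sector F) (sector F')) => [ss|ss|].
- by apply: sym; exact: meet_front.
- exact: meet_front.
(* Within one sector, a flat facet and a pyramid exclude each other through [peak]; distinct facets
   of the same pyramid share an edge ending at the apex, and that edge separates them. *)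
case: F F' vF vF' fF fF' => // s [] //= s' sk sk' _ _; rewrite /peak in sk sk'.
- by move=> ->.
- lia.
- lia.
- lia.
- lia.
- by move/double_inj => ->.
- by move/double_inj <-; apply: sym; exact: meet_right_left.
- by move/double_inj <-; exact: meet_left_far.
- lia.
- by move/double_inj <-; exact: meet_right_left.
- by move/double_inj => ->.
- by move/double_inj <-; apply: sym; exact: meet_far_right.
- lia.
- by move/double_inj <-; apply: sym; exact: meet_left_far.
- by move/double_inj <-; exact: meet_far_right.
- by move/double_inj => ->.
Qed.

Definition bary1 F := bary (proj (corner1 F)) (proj (corner2 F)) (proj (corner3 F)).
Definition bary2 F := bary (proj (corner2 F)) (proj (corner3 F)) (proj (corner1 F)).
Definition bary3 F := bary (proj (corner3 F)) (proj (corner1 F)) (proj (corner2 F)).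

Lemma shapeP F q : valid F -> shape F q <->
  [/\ 0 <= bary1 F q, 0 <= bary2 F q & 0 <= bary3 F q].
Proof. by move=> vF; apply: triangleP; exact: facet_area_neq0. Qed.

Lemma shape_interiorP F q : valid F -> (shape F)° q <->
  [/\ 0 < bary1 F q, 0 < bary2 F q & 0 < bary3 F q].
Proof. by move=> vF; apply: interior_triangleP; exact: facet_area_neq0. Qed.

(** * The facets cover the triangle with corners 0, [e 0] and [e L] *)

Definition side1 : R * R * R := (1, 0, 0).
Definition side2 : R * R * R := (0, 1, 0).
Definition side3 : R * R * R := (- L%:R, -1, L%:R ^+ 2).

Definition big_triangle : set (pt2 R) :=
  [set x | [/\ 0 <= aff side1 x, 0 <= aff side2 x & 0 <= aff side3 x]].

Lemma aff_triangle_ge0 l (x y z q : pt2 R) : triangle x y z q ->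
  0 <= aff l x -> 0 <= aff l y -> 0 <= aff l z -> 0 <= aff l q.
Proof.
move=> [a [b [c [a0 b0 c0 abc ->]]]] lx ly lz.
suff -> : aff l (a *: x + b *: y + c *: z) = a * aff l x + b * aff l y + c * aff l z.
  by rewrite !addr_ge0 // mulr_ge0.
have -> : a = 1 - b - c by lra.
elim/pt2_ind: x {lx} => ? ?; elim/pt2_ind: y {ly} => ? ?; elim/pt2_ind: z {lz} => ? ?.
by rewrite !ptE /aff /=; ring.
Qed.

Lemma big_curve j : (j <= L)%N -> big_triangle (e j).
Proof.
move=> jL; have h : j%:R <= L%:R :> R by rewrite ler_nat.
have h0 : 0 <= j%:R :> R by [].
split; rewrite /aff /=; [lra| |nra].
by rewrite mul0r mul1r add0r addr0 sqr_ge0.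
Qed.

Lemma big_origin : big_triangle 0.
Proof. by split; rewrite /aff /= !mulr0 ?addr0 // ?add0r sqr_ge0. Qed.

Lemma big_centroid j : (j < L)%N -> big_triangle (centroid R L j).
Proof.
move=> jL; have [a1 a2 a3] := big_origin.
have [b1 b2 b3] := big_curve (ltnW jL); have [c1 c2 c3] := big_curve jL.
by split; rewrite aff_centroid divr_ge0 // addr_ge0 // addr_ge0.
Qed.

Lemma big_proj i : big_triangle (proj i).
Proof.
case: (vertexP i) => [[j jL ->]| ->|[s sk ->]].
- by rewrite proj_E //; exact: big_curve.
- by rewrite proj_P0; exact: big_origin.
- by rewrite proj_A //; apply: big_centroid; lia.
Qed.

Lemma shape_big F q : shape F q -> big_triangle q.
Proof.
have [a1 a2 a3] := big_proj (corner1 F); have [b1 b2 b3] := big_proj (corner2 F).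
have [c1 c2 c3] := big_proj (corner3 F).
by move=> h; split; apply: (aff_triangle_ge0 h).
Qed.

(** These are barycentric coordinates in the sector triangle. The one at 0 drops out because that
    corner is the zero vector, so the decomposition makes sense on the whole cone. *)
Lemma cone_decomp j x : (j < L)%N -> 0 <= phi j x -> phi j.+1 x <= 0 ->
  exists b c : R, [/\ 0 <= b, 0 <= c, x = b *: e j + c *: e j.+1,
    phi j.+1 x < 0 -> 0 < b & 0 < phi j x -> 0 < c].
Proof.
move=> jL h1 h2; have D := area_origin_lt0 R jL.
have D1 : signed_area (e j.+1) 0 (e j) < 0 by rewrite area_rot area_rot.
have D2 : signed_area (e j) (e j.+1) 0 < 0 by rewrite area_rot.
exists (bary (e j) (e j.+1) 0 x), (bary (e j.+1) 0 (e j) x); split.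
- by rewrite /bary nmulr_lge0 ?invr_lt0 // -aff_line.
- by rewrite /bary nmulr_lge0 ?invr_lt0 // area_ray oppr_le0.
- have [] := @bary_decomp R 0 (e j) (e j.+1) x; first by rewrite lt_eqF.
  by rewrite scaler0 add0r.
- by rewrite /bary => h; rewrite nmulr_lgt0 ?invr_lt0 // -aff_line.
- by rewrite /bary => h; rewrite nmulr_lgt0 ?invr_lt0 // area_ray oppr_lt0.
Qed.

Lemma cover_front j x : (j < L)%N -> 0 <= phi j x -> phi j.+1 x <= 0 ->
  signed_area (e j) (e j.+1) x <= 0 -> exists2 F, valid F & shape F x.
Proof.
move=> jL h1 h2 h3.
have D := area_origin_lt0 R jL.
have : triangle 0 (e j) (e j.+1) x.
  apply/triangleP; first by rewrite lt_eqF.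
  have D1 : signed_area (e j.+1) 0 (e j) < 0 by rewrite area_rot area_rot.
  have D2 : signed_area (e j) (e j.+1) 0 < 0 by rewrite area_rot.
  rewrite /bary; split; rewrite nmulr_lge0 ?invr_lt0 //.
    by rewrite -aff_line.
  by rewrite area_ray oppr_le0.
move=> [a [b [c [a0 b0 c0 abc ->]]]].
have [pj|npj] := boolP (peak j); last first.
  have vF : valid (Flat j) by rewrite /= jL.
  exists (Flat j) => //; have := projsE vF => -[]; rewrite /shape /= => -> -> ->.
  by exists a, b, c.
have [s jE sk] : exists2 s, j = s.*2 & (s < k)%N.
  by exists j./2; move: pj; rewrite /peak => /andP[]; lia.
rewrite {h1 h2 h3 D pj}jE in jL *.
(* Weight [m] taken from each corner becomes weight [3 * m] at the centroid. With [m] the least of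
   the three weights, one corner disappears and the point lies on the pyramid face that avoids
   it. *)
have comb (m : R) : a *: (0 : pt2 R) + b *: e s.*2 + c *: e s.*2.+1 =
    (a - m) *: (0 : pt2 R) + (b - m) *: e s.*2 + (c - m) *: e s.*2.+1 +
    (3 * m) *: centroid R L s.*2.
  by rewrite /centroid /curve !ptE /GRing.scale /=; congr pair; field.
have case_left : c <= a -> c <= b -> 
    exists2 F, valid F & shape F (a *: (0 : pt2 R) + b *: e s.*2 + c *: e s.*2.+1).
  move=> ca cb; exists (FLeft s) => //; rewrite /shape.
  have [-> -> ->] := projsE (F := FLeft s) sk.
  exists (a - c), (b - c), (3 * c); split; [lra|lra|lra|lra|].
  by rewrite (comb c) subrr scale0r addr0.
have case_right : b <= a -> b <= c -> 
    exists2 F, valid F & shape F (a *: (0 : pt2 R) + b *: e s.*2 + c *: e s.*2.+1).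
  move=> ba bc; exists (FRight s) => //; rewrite /shape.
  have [-> -> ->] := projsE (F := FRight s) sk.
  exists (a - b), (3 * b), (c - b); split; [lra|lra|lra|lra|].
  by rewrite (comb b) subrr scale0r addr0 addrAC.
have case_far : a <= b -> a <= c -> 
    exists2 F, valid F & shape F (a *: (0 : pt2 R) + b *: e s.*2 + c *: e s.*2.+1).
  move=> ab ac; exists (Far s) => //; rewrite /shape.
  have [-> -> ->] := projsE (F := Far s) sk.
  exists (3 * a), (b - a), (c - a); split; [lra|lra|lra|lra|].
  by rewrite (comb a) subrr scale0r add0r addrC addrA.
have [ab|/ltW ba] := leP a b.
  by have [ac|/ltW ca] := leP a c; [exact: case_far|apply: case_left; lra].
by have [bc|/ltW cb] := leP b c; [exact: case_right|apply: case_left; lra].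
Qed.

Lemma cover_back x : big_triangle x ->
  (forall j, (j < L)%N -> 0 <= signed_area (e j) (e j.+1) x) ->
  exists2 F, valid F & shape F x.
Proof.
move=> [x1 x2 x3] H.
(* The search starts at 1 because the diagonal from [e 0] to itself is degenerate; the point is past
   the diagonal to [e 1] as it lies beyond the first chord. *)
have [|||i [i1 iL Fi Fi1]] := @sign_change R (fun i => signed_area (e 0) (e i) x) 1 L.
- lia.
- by apply: H; lia.
- have -> : signed_area (e 0) (e L) x = - L%:R * aff side3 x.
    by rewrite /signed_area /aff /=; ring.
  by rewrite mulNr oppr_le0 mulr_ge0.
have vF : valid (Back i) by rewrite /= i1.
exists (Back i) => //; apply/shapeP => //.
have D := facet_area_sign vF; move: D.
rewrite /bary1 /bary2 /bary3 /bary /facet_area /= !proj_E; try lia.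
move=> D; have D1 : 0 < signed_area (e i) (e i.+1) (e 0) by rewrite area_rot.
have D2 : 0 < signed_area (e i.+1) (e 0) (e i) by rewrite area_rot area_rot.
split; rewrite pmulr_lge0 ?invr_gt0 //; first exact: H.
by rewrite area_swap oppr_ge0.
Qed.

Lemma cover x : big_triangle x -> exists2 F, valid F & shape F x.
Proof.
move=> bx; have [x1 x2 x3] := bx.
have [|||j [_ jL Fj Fj1]] := @sign_change R (fun j => phi j x) 0 L.
- lia.
- have -> : phi 0 x = L%:R ^+ 2 * aff side1 x by rewrite /aff /ray /=; ring.
  by rewrite mulr_ge0 // sqr_ge0.
- have -> : phi L x = - L%:R * aff side2 x by rewrite /aff /ray /=; ring.
  by rewrite mulNr oppr_le0 mulr_ge0.
have [h|/ltW h] := leP (signed_area (e j) (e j.+1) x) 0; first exact: cover_front h.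
(* Beyond its own chord, [x] is a combination of [e j], [e j.+1] and 0 in which 0 has a weight at
   most 0. Every chord has the curve points on its nonnegative side and 0 on its negative side, so
   [x] is beyond all chords. *)
apply: cover_back => // l lL.
have D := area_origin_lt0 R jL.
have [b [c [b0 c0 xE _ _]]] := cone_decomp jL Fj Fj1.
have {}xE : x = (1 - b - c) *: (0 : pt2 R) + b *: e j + c *: e j.+1.
  by rewrite scaler0 add0r.
have D' m : (m < L)%N -> signed_area (e m) (e m.+1) 0 < 0.
  by move=> mL; rewrite area_rot area_origin_lt0.
rewrite xE area_comb; last ring.
move: h; rewrite xE area_comb; last ring.
rewrite !area_refl !mulr0 !addr0 nmulr_lge0 ?D' // => a0.
have h0 : 0 <= (1 - b - c) * signed_area (e l) (e l.+1) 0.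
  by rewrite mulr_le0 // ltW // D'.
by rewrite addr_ge0 ?mulr_ge0 ?area_chord_ge0 // addr_ge0 // mulr_ge0 ?area_chord_ge0.
Qed.

Lemma aff_conv l x y (t : R) :
  aff l (x + t *: (y - x)) = (1 - t) * aff l x + t * aff l y.
Proof.
elim/pt2_ind: x => ? ?; elim/pt2_ind: y => ? ?.
by rewrite !ptE /GRing.scale /=; ring.
Qed.

Lemma convex_aff_gt0 l : convex_in [set x : pt2 R | 0 < aff l x].
Proof.
move=> x y t /= lx ly /andP[t0 t1]; rewrite aff_conv.
move: t0; rewrite le_eqVlt => /orP[/eqP <-|t0]; first by rewrite subr0 mul1r mul0r addr0.
by rewrite ltr_wpDl ?mulr_gt0 // mulr_ge0 ?subr_ge0 // ltW.
Qed.

Lemma convex_inI (S T : set (pt2 R)) : convex_in S -> convex_in T -> convex_in (S `&` T).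
Proof. by move=> cS cT x y t [Sx Tx] [Sy Ty] t01; split; [exact: cS|exact: cT]. Qed.

Lemma big_interiorP x : big_triangle° x <->
  [/\ 0 < aff side1 x, 0 < aff side2 x & 0 < aff side3 x].
Proof.
split.
  move=> h; split; apply: interior_aff_gt0 h; rewrite ?xpair_eqE ?eqxx ?oner_eq0 ?andbF //=.
  - by move=> y [].
  - by move=> y [].
  - by rewrite negb_and orbC oppr_eq0 oner_eq0.
  - by move=> y [].
move=> [/aff_gt0_near x0 /aff_gt0_near y0 /aff_gt0_near z0].
apply: (filterS _ (filterI x0 (filterI y0 z0))) => y /= [x1 [y1 z1]].
by split; apply: ltW.
Qed.

Lemma connected_big_interior : connected big_triangle°.
Proof.
have -> : big_triangle° = [set x | 0 < aff side1 x] `&`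
    ([set x | 0 < aff side2 x] `&` [set x | 0 < aff side3 x]).
  by apply/seteqP; split=> x; [move=> /big_interiorP[]|move=> [? []] ? ?; apply/big_interiorP].
by apply: convex_connected; apply: convex_inI (convex_inI _ _); exact: convex_aff_gt0.
Qed.

Definition opp_line (l : R * R * R) : R * R * R := (- l.1.1, - l.1.2, - l.2).

Lemma aff_opp l x : aff (opp_line l) x = - aff l x.
Proof. by rewrite /aff /=; ring. Qed.

(** The complement is a union of three open half-planes, and the second one meets each of the other
    two. *)
Lemma connected_big_compl : connected (~` big_triangle).
Proof.
have -> : ~` big_triangle = [set x | 0 < aff (opp_line side1) x] `|`
    [set x | 0 < aff (opp_line side2) x] `|` [set x | 0 < aff (opp_line side3) x].
  apply/seteqP; split=> x /=; rewrite !aff_opp !oppr_gt0 !ltNge.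
    move=> nb; apply: contrapT => h; apply: nb.
    by split; apply: contrapT => /negP h'; apply: h; [left; left|left; right|right].
  by move=> [[|]|] /negP h []; move=> *; apply: h.
have c l : connected [set x : pt2 R | 0 < aff l x].
  by apply: convex_connected; exact: convex_aff_gt0.
apply: connectedU => //.
  exists (L%:R ^+ 2 + 1, -1); split; rewrite /= ?aff_opp /aff /=.
    by right; lra.
  have : 3 <= L%:R :> R by rewrite ler_nat; lia.
  by nra.
apply: connectedU => //.
by exists (-1, -1); split; rewrite /= ?aff_opp /aff /=; lra.
Qed.

(** * Assembling the terrain *)

Definition facet_sets : {set {set 'I_n}} :=
  [set f | `[< exists2 F, valid F & f = corners F >]]%SET.

Lemma facet_setsP f : f \in facet_sets -> exists2 F, valid F & f = corners F.
Proof. by rewrite inE => /asboolP. Qed.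

Lemma facet_sets_corners F : valid F -> corners F \in facet_sets.
Proof. by move=> vF; rewrite inE; apply/asboolP; exists F. Qed.

Lemma domainE : \bigcup_(f in [set f | f \in facet_sets]) hull proj f = big_triangle.
Proof.
apply/seteqP; split=> x.
  by move=> [f /= /facet_setsP[F vF ->] /(hull_shape _ vF)]; exact: shape_big.
by move=> /cover[F vF sF]; exists (corners F); [exact: facet_sets_corners|exact/hull_shape].
Qed.

Lemma card_corners F : valid F -> #|corners F| = 3%N.
Proof.
move=> /corners_neq[h1 h2 h3]; rewrite /corners -finset.setUA cardsU1 cards2 !inE.
by rewrite negb_or h1 h2 h3.
Qed.

Lemma corners_area F i j m : valid F -> i \in corners F -> j \in corners F ->
  m \in corners F -> i != j -> j != m -> i != m ->
  signed_area (proj i) (proj j) (proj m) != 0.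
Proof.
move=> /facet_area_neq0; rewrite /facet_area /corners.
move: proj (corner1 F) (corner2 F) (corner3 F) => p a b c D.
have D1 : signed_area (p b) (p c) (p a) != 0 by rewrite area_rot.
have D2 : signed_area (p c) (p a) (p b) != 0 by rewrite area_rot.
have D3 : signed_area (p a) (p c) (p b) != 0 by rewrite area_swapr oppr_eq0.
have D4 : signed_area (p c) (p b) (p a) != 0 by rewrite area_rot.
have D5 : signed_area (p b) (p a) (p c) != 0 by rewrite area_rot.
by rewrite !inE => /orP[/orP[]|] /eqP -> /orP[/orP[]|] /eqP -> /orP[/orP[]|] /eqP ->;
  rewrite ?eqxx.
Qed.

Lemma vertex_in_facet i : exists2 F, valid F & i \in corners F.
Proof.
case: (vertexP i) => [[j jL ->]| ->|[s sk ->]].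
- have [->|j0] := posnP j.
    by exists (Back 1); rewrite ?inE ?eqxx //=; lia.
  have [jL'|Lj] := ltnP j L; first by exists (Back j); rewrite ?inE ?eqxx ?orbT //= j0.
  have -> : j = L.-1.+1 by lia.
  by exists (Back L.-1); rewrite ?inE ?eqxx ?orbT //=; lia.
- by exists (FLeft 0); rewrite ?inE ?eqxx.
- by exists (FLeft s); rewrite ?inE ?eqxx ?orbT.
Qed.

Definition fan : terrain R n.
Proof.
refine (@Terrain R n vertex facet_sets _ _ _ _ _ _).
- by move=> f /facet_setsP[F vF ->]; exact: card_corners.
- by move=> f i j m /facet_setsP[F vF ->]; exact: corners_area.
- by move=> i; have [F vF iF] := vertex_in_facet i; exists (corners F) => //; exact: facet_sets_corners.
- by move=> f g /facet_setsP[F vF ->] /facet_setsP[G vG ->]; exact: facets_meet.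
- by rewrite domainE; exact: connected_big_interior.
- by rewrite domainE; exact: connected_big_compl.
Defined.

(** * Prickliness *)

Local Notation T := fan.

(** The open cone over the sector of pyramid [s]. It is unbounded, so it contains the shadow as well
    as the inside of the pyramid. *)
Definition in_peak s x := 0 < phi s.*2 x /\ phi s.*2.+1 x < 0.

Lemma phi_comb j (a b c : R) (x y z : pt2 R) :
  phi j (a *: x + b *: y + c *: z) = a * phi j x + b * phi j y + c * phi j z.
Proof. by rewrite !affD_ray !affZ_ray. Qed.

Lemma surfaceP q : surface T q <-> exists2 F, valid F & exists a b c : R,
  [/\ 0 <= a, 0 <= b, 0 <= c, a + b + c = 1 &
  q = a *: vertex (corner1 F) + b *: vertex (corner2 F) + c *: vertex (corner3 F)].
Proof.
split.
  move=> [f /= /facet_setsP[F vF ->]]; have [h1 h2 h3] := corners_neq vF.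
  by move/(hull3P _ _ h1 h2 h3) => H; exists F.
move=> [F vF H]; exists (corners F); first exact: facet_sets_corners.
by have [h1 h2 h3] := corners_neq vF; apply/hull3P.
Qed.

Lemma surface_over x : big_triangle x -> exists2 h : R, 0 <= h & surface T (x, h).
Proof.
move=> /cover[F vF [a [b [c [a0 b0 c0 abc xE]]]]].
set q := a *: vertex (corner1 F) + b *: vertex (corner2 F) + c *: vertex (corner3 F).
have v0 i : 0 <= (vertex i).2.
  case: (vertexP i) => [[j jL ->]| ->|[s sk ->]].
  - by rewrite vertex_E.
  - by rewrite vertex_P0.
  - by rewrite vertex_A.
exists q.2; first by rewrite /q /= !addr_ge0 // mulr_ge0.
apply/surfaceP; exists F => //; exists a, b, c; split => //.
by rewrite xE /q [RHS]surjective_pairing.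
Qed.

Lemma phi_centroid s : (s < k)%N -> in_peak s (centroid R L s.*2).
Proof.
move=> sk; rewrite /in_peak !aff_centroid !aff_ray0 !ray_curve_eq0 !addr0 !add0r.
rewrite pmulr_lgt0 // pmulr_llt0 //.
by rewrite ray_curve_gt0 ?ray_curve_lt0 //; lia.
Qed.

Lemma comb_gt0 (a b x y : R) : 0 <= a -> 0 < x -> 0 < b -> 0 < y -> 0 < a * x + b * y.
Proof. by move=> *; rewrite ltr_wpDl ?mulr_gt0 // mulr_ge0 // ltW. Qed.

Lemma comb_lt0 (a b x y : R) : 0 <= a -> x < 0 -> 0 < b -> y < 0 -> a * x + b * y < 0.
Proof.
move=> a0 x0 b0 y0; rewrite -oppr_gt0 opprD -!mulrN.
by apply: comb_gt0; rewrite ?oppr_gt0.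
Qed.

(** Only apexes have nonzero height, so the height of a point of a pyramid is the weight of its
    apex. Positive heights matter for visibility, height 1 for the convexity of the apexes. *)
Lemma surface_height q : surface T q ->
  0 <= q.2 <= 1 /\
  (0 < q.2 -> exists2 s, (s < k)%N & in_peak s q.1) /\
  (1 <= q.2 -> exists2 s, (s < k)%N & q = vertex (A s)).
Proof.
move=> /surfaceP[F vF [a [b [c [a0 b0 c0 abc ->]]]]].
have key s (t u v : R) : (s < k)%N -> 0 < v -> 0 <= t -> 0 <= u ->
    in_peak s (t *: e s.*2 + u *: e s.*2.+1 + v *: centroid R L s.*2).
  move=> sk v0 t0 u0; have [h1 h2] := phi_centroid sk.
  rewrite /in_peak !phi_comb !ray_curve_eq0 !mulr0 addr0 add0r.
  have h3 : 0 < phi s.*2 (e s.*2.+1) by rewrite ray_curve_gt0 //; lia.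
  have h4 : phi s.*2.+1 (e s.*2) < 0 by rewrite ray_curve_lt0 //; lia.
  by split; [exact: comb_gt0|exact: comb_lt0].
have low : 0 <= (0 : R) <= 1 by rewrite lexx ler01.
case: F vF => /= s sk.
- rewrite !vertex_E; try lia.
  by rewrite /= !scaler0 !addr0; split; [exact: low|split; lra].
- rewrite vertex_P0 !vertex_E; try lia.
  by rewrite /= !scaler0 !addr0; split; [exact: low|split; lra].
- rewrite vertex_P0 vertex_E ?vertex_A //; try lia.
  rewrite /= !scaler0 !add0r [c *: 1]mulr1; split; first lra.
  split => h; first by exists s => //; have := key s b 0 c sk h b0 (lexx 0); rewrite scale0r addr0.
  have -> : c = 1 by lra.
  have -> : b = 0 by lra.
  by exists s; rewrite ?vertex_A // scale0r scale1r add0r.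
- rewrite vertex_P0 vertex_E ?vertex_A //; try lia.
  rewrite /= !scaler0 !add0r addr0 [b *: 1]mulr1; split; first lra.
  split => h.
    by exists s => //; have := key s 0 c b sk h (lexx 0) c0; rewrite scale0r add0r addrC.
  have -> : b = 1 by lra.
  have -> : c = 0 by lra.
  by exists s; rewrite ?vertex_A // scale0r scale1r addr0.
- rewrite vertex_A // !vertex_E; try lia.
  rewrite /= !scaler0 !addr0 [a *: 1]mulr1; split; first lra.
  split => h.
    by exists s => //; have := key s b c a sk h b0 c0; rewrite addrC addrA.
  have -> : a = 1 by lra.
  have -> : b = 0 by lra.
  have -> : c = 0 by lra.
  by exists s; rewrite ?vertex_A // !scale0r scale1r !addr0.
Qed.

Lemma cone_after j m x : (j < m)%N -> (m <= L)%N -> 0 <= phi j x ->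
  phi j.+1 x <= 0 -> phi m x <= 0.
Proof.
move=> jm mL h1 h2; have [|b [c [b0 c0 -> _ _]]] := cone_decomp _ h1 h2; first lia.
rewrite affD_ray !affZ_ray.
have l1 : phi m (e j) <= 0 by rewrite ltW // ray_curve_lt0.
suff l2 : phi m (e j.+1) <= 0 by nra.
by move: jm; rewrite leq_eqVlt => /orP[/eqP <-|jm];
  rewrite ?ray_curve_eq0 // ltW // ray_curve_lt0.
Qed.

Lemma in_peak_uniq s s' x : (s < k)%N -> (s' < k)%N -> in_peak s x -> in_peak s' x -> s = s'.
Proof.
have H r r' : (r < r')%N -> (r' < k)%N -> in_peak r x -> in_peak r' x -> False.
  move=> rr rk [/ltW h1 /ltW h2] [h3 _]; have := @cone_after r.*2 r'.*2 x.
  by move=> /(_ _ _ h1 h2); rewrite leNgt h3 => /(_ ltac:(lia) ltac:(lia)).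
by move=> sk sk' h h'; case: (ltngtP s s') => // ss; exfalso; [exact: (H s s')|exact: (H s' s)].
Qed.

Lemma in_peak_near s x : in_peak s x -> \forall y \near x, in_peak s y.
Proof.
move=> [h1 h2]; have h3 : 0 < aff (opp_line (ray R L s.*2.+1)) x by rewrite aff_opp oppr_gt0.
apply: (filterS _ (filterI (aff_gt0_near h1) (aff_gt0_near h3))) => y /= [h4].
by rewrite aff_opp oppr_gt0.
Qed.

Lemma in_peakZ s x (t : R) : 0 < t -> in_peak s (t *: x) <-> in_peak s x.
Proof. by move=> t0; rewrite /in_peak !affZ_ray pmulr_rgt0 // pmulr_rlt0. Qed.

Lemma in_peak_curve s j : (s < k)%N -> (j <= L)%N -> ~ in_peak s (e j).
Proof.
move=> sk jL [h1 h2]; have [js|sj] := leqP j s.*2.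
  move: h1; rewrite ltNge; move: js; rewrite leq_eqVlt => /orP[/eqP ->|js].
    by rewrite ray_curve_eq0 lexx.
  by rewrite ltW // ray_curve_lt0 //; lia.
move: h2; rewrite ltNge; move: sj; rewrite leq_eqVlt => /orP[/eqP <-|js].
  by rewrite ray_curve_eq0 lexx.
by rewrite ltW // ray_curve_gt0 //; lia.
Qed.

Lemma domain_fan : domain T = big_triangle.
Proof. exact: domainE. Qed.

Lemma curve_not_convex j : (0 < j < L)%N -> internal_vertex T (E j) ->
  ~ convex_vertex T (E j).
Proof.
move=> jL; rewrite /internal_vertex /convex_vertex domain_fan.
rewrite -[xy T _]/(proj (E j)) -[vtx T _]/(vertex (E j)) proj_E ?vertex_E; try lia.
(* The line through 0 and e j stays on the surface at height 0 on both sides of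
   e j, which is impossible below a plane touching only at e j. *)
move=> int [a [b]] H.
have [u u0 Hu] := near_line (e j) int.
have [v v0 Hv] := near_line ((e j, 0) : pt3 R) H.
pose t := Num.min (u / 2) (Num.min (v / 2) (1 / 2)).
have t0 : 0 < t by rewrite !lt_min !divr_gt0.
have tu : t < u by rewrite !gt_min; apply/orP; left; lra.
have tv : t < v by rewrite !gt_min; apply/orP; right; apply/orP; left; lra.
have t1 : t <= 1 by rewrite !ge_min; apply/orP; right; apply/orP; right; lra.
have e0 (r : R) : r != 0 -> ((e j, 0) : pt3 R) + r *: ((e j, 0) : pt3 R) <> (e j, 0).
  move=> r0 /(congr1 (fun q => q.1.1 - (e j).1)) /=; rewrite subrr addrAC subrr add0r.
  by move/eqP; rewrite mulf_eq0 (negbTE r0) pnatr_eq0 /=; lia.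
(* Outward, the ray through [e j] lies in no open cone [in_peak], so the surface has height 0 over
   it; inward, in [s2], it follows the edge from 0 to [e j]. *)
have s1 : surface T ((e j, 0) + t *: (e j, 0)).
  have : big_triangle (e j + t *: e j) by apply: Hu; rewrite gtr0_norm.
  move=> /surface_over[h h0 hS]; have [/andP[_ _] [hp _]] := surface_height hS.
  have -> : ((e j, 0) : pt3 R) + t *: ((e j, 0) : pt3 R) = (e j + t *: e j, h).
    move: h0; rewrite le_eqVlt => /orP[/eqP <-|/hp[s sk /= ]].
      by congr pair; rewrite /= scaler0 addr0.
    rewrite -[X in X + _]scale1r -scalerDl in_peakZ ?addr_gt0 // => /in_peak_curve.
    by case; lia.
  exact: hS.
have s2 : surface T ((e j, 0) + (- t) *: (e j, 0)).
  apply/surfaceP.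
  have E' : ((e j, 0) : pt3 R) + (- t) *: ((e j, 0) : pt3 R) =
      t *: 0 + (1 - t) *: ((e j, 0) : pt3 R).
    by rewrite scaler0 add0r scalerBl scale1r scaleNr.
  have [F [vF F1 F2]] : exists F, [/\ valid F, corner1 F = P0 & corner2 F = E j].
    have [pj|npj] := boolP (peak j).
      by exists (FLeft j./2); move: pj => /andP[]; split => //=; [lia|congr E; lia].
    by exists (Flat j); split => //=; rewrite npj; lia.
  exists F => //; exists t, (1 - t), 0; split; [lra|lra|lra|lra|].
  by rewrite F1 F2 vertex_P0 vertex_E; [rewrite scale0r addr0|lia].
have h1 := Hv t; rewrite gtr0_norm // in h1.
have {h1} h1 := h1 tv s1 (e0 _ (lt0r_neq0 t0)).
have h2 := Hv (- t); rewrite normrN gtr0_norm // in h2.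
have nt0 : - t != 0 by rewrite oppr_eq0 lt0r_neq0.
have {h2} h2 := h2 tv s2 (e0 _ nt0).
pose D := a * (e j).1 + b * (e j).2.
have hD (r : R) :
    a * ((e j + r *: e j).1 - (e j).1) + b * ((e j + r *: e j).2 - (e j).2) = r * D.
  exact: slope_move.
move: h1 h2; rewrite /= !scaler0 !addr0 !add0r.
rewrite -[X in _ < X]/(a * ((e j + t *: e j).1 - (e j).1) +
  b * ((e j + t *: e j).2 - (e j).2)).
rewrite hD => h1.
rewrite -[X in _ < X]/(a * ((e j + (- t) *: e j).1 - (e j).1) +
  b * ((e j + (- t) *: e j).2 - (e j).2)).
by rewrite hD mulNr oppr_gt0 => /ltW; rewrite leNgt h1.
Qed.

Lemma boundary_not_internal i : (forall j, (0 < j < L)%N -> i <> E j) ->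
  (forall s, (s < k)%N -> i <> A s) -> ~ internal_vertex T i.
Proof.
move=> nE nA; rewrite /internal_vertex domain_fan -[xy T _]/(proj i).
move=> /big_interiorP; case: (vertexP i) => [[j jL ij]| -> |[s sk /nA]]; last exact.
  rewrite ij proj_E // => -[h1 h2 _].
  have [j0|j0] := posnP j; first by move: h1; rewrite /aff /= j0; lra.
  have [jL'|Lj] := ltnP j L; first by case: (nE j); rewrite ?j0.
  have jE : j = L by lia.
  by move: h2; rewrite /aff /= jE subrr expr0n /=; lra.
by rewrite proj_P0 => -[]; rewrite /aff /=; lra.
Qed.

Lemma apex_internal s : (s < k)%N -> internal_vertex T (A s).
Proof.
move=> sk; rewrite /internal_vertex domain_fan -[xy T _]/(proj (A s)) proj_A //.
apply/big_interiorP; rewrite !aff_centroid.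
have [a1 a2 a3] : big_triangle (e s.*2) by apply: big_curve; lia.
have [b1 b2 b3] : big_triangle (e s.*2.+1) by apply: big_curve; lia.
have [z1 z2 z3] := big_origin.
have c1 : 0 < aff side1 (e s.*2.+1).
  by rewrite /aff /= mul1r mul0r !addr0 ltr0n.
have c2 : 0 < aff side2 (e s.*2).
  rewrite /aff /= mul1r mul0r add0r addr0 exprn_gt0 // subr_gt0 ltr_nat; lia.
have c3 : 0 < aff side3 0.
  rewrite /aff /= !mulr0 !add0r exprn_gt0 // ltr0n; lia.
split; rewrite divr_gt0 //.
- by rewrite ltr_wpDl // addr_ge0.
- by rewrite ltr_pwDl // ltr_wpDl.
- by rewrite ltr_pwDl // ltr_pwDl.
Qed.

(** The horizontal plane at height 1 works: only apexes reach it, and the open cone of pyramid [s]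
    contains a neighbourhood of [A s] but no other apex. *)
Lemma apex_convex s : (s < k)%N -> convex_vertex T (A s).
Proof.
move=> sk; exists 0, 0; rewrite -[vtx T _]/(vertex (A s)) vertex_A //.
have pk := in_peak_near (phi_centroid sk).
have : \forall q \near ((centroid R L s.*2, 1) : pt3 R), in_peak s q.1.
  exact: (@cvg_fst _ _ (nbhs (centroid R L s.*2)) (nbhs (1 : R^o)) _ _ pk).
apply: filterS => q qs /surface_height[/andP[_ q1] [_ H]] qne.
rewrite !mul0r !addr0 lt_neqAle q1 andbT; apply/eqP => qE; apply: qne.
have [|s' sk' qA] := H; first by rewrite qE.
rewrite qA vertex_A //; congr (centroid R L _.*2, 1).
apply: (@in_peak_uniq s' s q.1) => //.
by rewrite qA vertex_A //; exact: phi_centroid.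
Qed.

Lemma vertex_height i : (vertex i).2 = (L.+1 < i)%N%:R.
Proof.
case: (vertexP i) => [[j jL ->]| ->|[s sk ->]].
- by rewrite vertex_E // val_E // ltnNge (leq_trans jL).
- by rewrite vertex_P0 val_P0 ltnn.
- by rewrite vertex_A // val_A // (_ : (_ < _)%N) //; lia.
Qed.

Lemma facet_apex_uniq F i j : valid F -> i \in corners F -> j \in corners F ->
  (L.+1 < i)%N -> (L.+1 < j)%N -> i = j.
Proof.
have H v : valid F -> v \in corners F -> (L.+1 < v)%N -> v = A (sector F)./2.
  case: F => s /= sk; rewrite !inE /= => /orP[/orP[]|] /eqP ->;
    by first [by rewrite val_P0 ltnn|by rewrite val_E; lia|by rewrite doubleK].
by move=> vF iF jF /(H i vF iF) -> /(H j vF jF).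
Qed.

Lemma apex_local_max s : (s < k)%N -> local_max T ((0, 0), 1) (A s).
Proof.
move=> sk j [ne [f [/facet_setsP[F vF ->] h1 h2]]].
rewrite /dot3 -![vtx T _]/(vertex _) /= !mulr0 !mulr1 !add0r !vertex_height.
have hA : (L.+1 < A s)%N by rewrite val_A //; lia.
rewrite hA; case: ltnP => hj; last by rewrite ltr01.
by move: ne; rewrite (facet_apex_uniq vF h1 h2 hA hj) eqxx.
Qed.

(** In any direction only apexes can be counted, and the vertical direction counts all of them: no
    facet has two apexes, so each apex is higher than its neighbors. *)
Lemma prickliness_fan : prickliness T = k.
Proof.
pose S : {set 'I_n} := [set A s | s : 'I_k]%SET.
have cS : #|S| = k.
  rewrite card_imset ?card_ord // => s s' /(congr1 val) /=.
  by rewrite !val_A // => /addnI /val_inj.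
apply/eqP; rewrite eqn_leq; apply/andP; split.
  apply/bigmax_leqP => i /asboolP[w <-]; rewrite -cS; apply: subset_leq_card.
  apply/fintype.subsetP => v; rewrite inE => /asboolP[hi hc _].
  apply: contrapT => nS; apply: (@boundary_not_internal v) => // [j jL vE|s sk vA].
    by move: hi hc; rewrite vE => hi; exact: curve_not_convex.
  by apply: nS; apply/imsetP; exists (Ordinal sk).
have kn : (k < n.+1)%N by rewrite /n; lia.
apply: (leq_trans _ (leq_bigmax_cond (Ordinal kn) _)) => //=.
apply/asboolP; exists ((0, 0), 1); rewrite -[RHS]cS; apply: eq_card => v.
rewrite inE; apply/asboolP/imsetP => [[hi hc _]|[s _ ->]].
  apply: contrapT => nS; apply: (@boundary_not_internal v) => // [j jL vE|s sk vA].
    by move: hi hc; rewrite vE => hi; exact: curve_not_convex.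
  by apply: nS; exists (Ordinal sk).
by split; [exact: apex_internal|exact: apex_convex|exact: apex_local_max].
Qed.

(** * The viewshed of the origin *)

Local Notation viewpoint := (vertex P0).

Lemma vertex_fst i : (vertex i).1 = proj i.
Proof. by []. Qed.

(* Unification otherwise unfolds these down to inord. *)
#[local] Opaque curve_vtx origin_vtx apex_vtx vertex proj.

Lemma hull_lift_uniq F q (c : 'I_n -> R) : valid F ->
  face3 T (corners F) q -> (forall i, i \notin corners F -> c i = 0) ->
  \sum_i c i = 1 -> q.1 = \sum_i c i *: proj i -> q = \sum_i c i *: vertex i.
Proof.
move=> vF /hullE[a [a0 as0 a1 ->]] cs c1 E1.
have [h1 h2 h3] := corners_neq vF.
have -> // : a = c; apply/funext.
apply: (bary_uniq h1 h2 h3 (facet_area_neq0 vF)) => //.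
by rewrite -E1 sum_fst; apply: eq_bigr => i _; rewrite -vertex_fst.
Qed.

(** The common projection lies in the hull of the corners shared by the two facets, and uniqueness
    of barycentric coordinates forces both points to be the same combination of the shared
    corners. *)
Lemma surface_inj q q' : surface T q -> surface T q' -> q.1 = q'.1 -> q = q'.
Proof.
move=> [f /= /facet_setsP[F vF ->] fq] [g /= /facet_setsP[G vG ->] gq] qq.
have : hull proj (corners F :&: corners G)%SET q.1.
  rewrite -facets_meet //; split.
    move/hullE : fq => [a [a0 as0 a1 ->]]; apply/hullE; exists a.
    by split; rewrite // sum_fst; apply: eq_bigr => i _; rewrite -vertex_fst.
  rewrite qq; move/hullE : gq => [a [a0 as0 a1 ->]]; apply/hullE; exists a.
  by split; rewrite // sum_fst; apply: eq_bigr => i _; rewrite -vertex_fst.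
move=> /hullE[c [c0 cs c1 qc]].
have cF i : i \notin corners F -> c i = 0 by move=> iF; apply: cs; rewrite inE negb_and iF.
have cG i : i \notin corners G -> c i = 0 by move=> iG; apply: cs; rewrite inE negb_and iG orbT.
by rewrite (hull_lift_uniq vF fq cF c1 qc) (hull_lift_uniq vG gq cG c1) // -qq.
Qed.

Definition lift F x : pt3 R := bary1 F x *: vertex (corner1 F) +
  bary2 F x *: vertex (corner2 F) + bary3 F x *: vertex (corner3 F).

Lemma face3P F q : valid F -> face3 T (corners F) q <-> shape F q.1 /\ q = lift F q.1.
Proof.
move=> vF; have [h1 h2 h3] := corners_neq vF; have D := facet_area_neq0 vF.
split=> [H|[/(shapeP _ vF)[a0 b0 c0] ->]]; last first.
  apply/(hull3P _ _ h1 h2 h3).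
  have [E1 _] := bary_decomp q.1 D.
  by exists (bary1 F q.1), (bary2 F q.1), (bary3 F q.1).
move/(hull3P _ _ h1 h2 h3) : (H) => [a [b [c [a0 b0 c0 abc qE]]]].
have sq : shape F q.1 by exists a, b, c; split => //; rewrite qE.
split => //.
have [E1 E2] := bary_decomp q.1 D; move/(shapeP _ vF) : (sq) => [u v w].
apply: surface_inj; first by exists (corners F) => //; exact: facet_sets_corners.
  by apply/surfaceP; exists F => //; exists (bary1 F q.1), (bary2 F q.1), (bary3 F q.1).
by rewrite {1}E2.
Qed.

Lemma lift_fst F x : valid F -> (lift F x).1 = x.
Proof. by move=> vF; have [_ E2] := bary_decomp x (facet_area_neq0 vF); rewrite [RHS]E2. Qed.

Lemma visible_partP F x : valid F ->
  visible_part T viewpoint (corners F) x <-> shape F x /\ visible T viewpoint (lift F x).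
Proof.
move=> vF; split.
  by move=> [q [/(face3P _ vF)[sq qE] [_ vq]] <-]; split => //; rewrite -qE.
move=> [sx vx]; exists (lift F x); last exact: lift_fst.
have fx : face3 T (corners F) (lift F x) by apply/face3P => //; rewrite lift_fst.
by split => //; split => //; exists (corners F) => //; exact: facet_sets_corners.
Qed.

Lemma visibleP q : visible T viewpoint q <->
  forall t q', 0 <= t <= 1 -> surface T q' -> q'.1 = t *: q.1 -> q'.2 <= t * q.2.
Proof.
rewrite /visible /segment3 vertex_P0; split.
  move=> H t q' t01 sq' q'1; rewrite leNgt; apply/negP => lt; rewrite -[False]/(set0 (t *: q)) -H.
  split; first by exists t => //; rewrite scaler0 add0r.
  by exists q'.
move=> H; apply/seteqP; split=> // r [[t t01 <-]]; rewrite scaler0 add0r.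
by move=> [q' [sq' q'1]]; rewrite ltNge => /negP; apply; exact: H.
Qed.

(** A facet with the viewpoint as a corner contains the whole line of sight to each of its points,
    and the surface is a graph, so nothing lies above that line. *)
Lemma front_visible F : valid F -> corner1 F = P0 ->
  visible_part T viewpoint (corners F) = shape F.
Proof.
move=> vF F1; apply/seteqP; split=> x; first by move=> /(visible_partP _ vF)[].
move=> sx; apply/visible_partP => //; split => //; apply/visibleP => t q' /andP[t0 t1] sq'.
rewrite lift_fst // => q'1.
have [u v w] : [/\ 0 <= bary1 F x, 0 <= bary2 F x & 0 <= bary3 F x] by apply/shapeP.
have E1 : bary1 F x + bary2 F x + bary3 F x = 1.
  by have [] := bary_decomp x (facet_area_neq0 vF).
have s : surface T (t *: lift F x).
  apply/surfaceP; exists F => //; rewrite /lift F1 vertex_P0 {sx}.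
  move: (bary1 F x) (bary2 F x) (bary3 F x) u v w E1 => a b c u v w E1.
  exists (1 - t + t * a), (t * b), (t * c).
  split; first by rewrite addr_ge0 ?subr_ge0 // mulr_ge0.
  - by rewrite mulr_ge0.
  - by rewrite mulr_ge0.
  - have -> : a = 1 - b - c by lra.
    by ring.
  by rewrite !scaler0 !add0r scalerDr !scalerA.
suff -> : q' = t *: lift F x by [].
by apply: surface_inj => //; rewrite q'1 -[in LHS](lift_fst x vF).
Qed.

Lemma back_lift i x : valid (Back i) -> lift (Back i) x = (x, 0).
Proof.
move=> vF; rewrite [LHS]surjective_pairing lift_fst //; congr pair.
by move: vF => /= iL; rewrite /lift /= !vertex_E /= ?scaler0 ?addr0 //; lia.
Qed.

Lemma peak_height s x : (s < k)%N -> in_peak s x ->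
  exists t h : R, [/\ 0 <= t <= 1, 0 < h & surface T (t *: x, h)].
Proof.
move=> sk [h1 h2]; have sL : (s.*2 < L)%N by lia.
have [b [c [_ _ xE /(_ h2) b0 /(_ h1) c0]]] := cone_decomp sL (ltW h1) (ltW h2).
have cent (u v : R) : u *: e s.*2 + v *: e s.*2.+1 =
    (u - v) *: e s.*2 + (3 * v) *: centroid R L s.*2.
  rewrite /centroid scalerA mulrAC mulfV ?pnatr_eq0 // mul1r scalerDr addrA.
  by rewrite -scalerDl subrK.
have cent' (u v : R) : u *: e s.*2 + v *: e s.*2.+1 =
    (3 * u) *: centroid R L s.*2 + (v - u) *: e s.*2.+1.
  rewrite /centroid scalerA mulrAC mulfV ?pnatr_eq0 // mul1r scalerDr -addrA.
  by rewrite -scalerDl [u + _]addrC subrK.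
(* Any small [t] would do. With this one the weight of 0 in [t *: x] is [t + t * b + t * c], larger
   than the other two, so the point falls on a face turned to the viewpoint. *)
have [t t0 tE] : exists2 t : R, 0 < t & t = 1 - (2 * (t * b) + 2 * (t * c)).
  have d0 : 0 < 1 + 2 * b + 2 * c by lra.
  exists (1 + 2 * b + 2 * c)^-1; first by rewrite invr_gt0.
  have := mulVf (lt0r_neq0 d0); move: (_^-1) => t; lra.
have tb : 0 < t * b by rewrite mulr_gt0.
have tc : 0 < t * c by rewrite mulr_gt0.
exists t; have [bc|/ltW cb] := leP b c.
- exists (3 * (t * b)); split; [lra|lra|].
  have tbc : t * b <= t * c by rewrite ler_pM2l.
  apply/surfaceP; exists (FRight s) => //.
  exists (1 - t * c - 2 * (t * b)), (3 * (t * b)), (t * c - t * b); split; [lra|lra|lra|lra|].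
  rewrite /= vertex_P0 vertex_A // vertex_E; last lia.
  rewrite scaler0 add0r xE; congr pair; last by rewrite /= scaler0 addr0 [_ *: _]mulr1.
  by rewrite /= scalerDr 2!scalerA cent'.
- exists (3 * (t * c)); split; [lra|lra|].
  have tbc : t * c <= t * b by rewrite ler_pM2l.
  apply/surfaceP; exists (FLeft s) => //.
  exists (1 - t * b - 2 * (t * c)), (t * b - t * c), (3 * (t * c)); split; [lra|lra|lra|lra|].
  rewrite /= vertex_P0 vertex_A // vertex_E; last lia.
  rewrite scaler0 add0r xE; congr pair; last by rewrite /= scaler0 add0r [_ *: _]mulr1.
  by rewrite /= scalerDr 2!scalerA cent.
Qed.

(** The line of sight stays at height 0, so only positive heights block it. These occur only over
    the cones [in_peak], which are invariant under scaling; conversely [peak_height] finds an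
    obstacle on each ray of such a cone. *)
Lemma back_visible i x : valid (Back i) ->
  visible_part T viewpoint (corners (Back i)) x <->
  shape (Back i) x /\ forall s, (s < k)%N -> ~ in_peak s x.
Proof.
move=> vF; rewrite visible_partP // back_lift //; split=> -[sx vx]; split => //.
  move=> s sk /(peak_height sk)[t [h [t01 h0 st]]].
  by move/visibleP : vx => /(_ t _ t01 st erefl) /=; rewrite mulr0 leNgt h0.
apply/visibleP => t q' /andP[t0 t1] /surface_height[_ [H _]] /= qt.
rewrite mulr0 leNgt; apply/negP => /H[s sk]; rewrite qt => ps; apply: (vx s sk).
move: t0; rewrite le_eqVlt => /orP[/eqP t0|t0]; last exact/(in_peakZ s x t0).
by move: ps; rewrite -t0 scale0r /in_peak !aff_ray0 ltxx => -[].
Qed.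

Lemma far_lift s x : (s < k)%N -> (lift (Far s) x).2 = bary1 (Far s) x.
Proof.
move=> sk; rewrite /lift /= vertex_A // !vertex_E; try lia.
by rewrite /= !scaler0 !addr0 [_ *: _]mulr1.
Qed.

(** The plane of the facet passes above the viewpoint. Over [(1 - d) *: x], still on the facet, the
    surface therefore exceeds the line of sight by [d] times the height of that plane over 0. *)
Lemma far_invisible s : (s < k)%N ->
  (visible_part T viewpoint (corners (Far s)))° = set0.
Proof.
move=> sk; have vF : valid (Far s) by [].
apply/seteqP; split=> // x Vx.
have Sx : (shape (Far s))° x.
  by apply: filterS Vx => y /(visible_partP _ vF)[].
have [u u0 Hu] := near_line (- x) Sx.
have /(visible_partP _ vF)[_ /visibleP H] := nbhs_singleton Vx.
pose d := Num.min (u / 2) 1.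
have d0 : 0 < d by rewrite lt_min; lra.
have d1 : d <= 1 by rewrite ge_min lexx orbT.
have du : d < u by rewrite gt_min; apply/orP; left; lra.
have sy : shape (Far s) ((1 - d) *: x).
  by rewrite scalerBl scale1r -scalerN; apply: Hu; rewrite gtr0_norm.
have := H (1 - d) (lift (Far s) ((1 - d) *: x)).
rewrite !lift_fst // !far_lift // leNgt => /(_ _ _ erefl) /negP; apply; first lra.
  exists (corners (Far s)); first exact: facet_sets_corners.
  by apply/face3P => //; rewrite lift_fst.
have -> : bary1 (Far s) ((1 - d) *: x) = (1 - d) * bary1 (Far s) x + d * bary1 (Far s) 0.
  rewrite /bary1 -!aff_bary_line; move: (bary_line _ _ _) => l.
  by rewrite aff_shrink opprB addrCA subrr addr0.
apply/negP; rewrite -ltNge ltrDl mulr_gt0 // /bary1 /bary.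
have := projsE vF => -[-> -> ->].
have [_ _ ->] := area_centroidE R L s.*2.
have a0 : signed_area 0 (e s.*2) (e s.*2.+1) < 0 by apply: area_origin_lt0; lia.
by rewrite area_rot nmulr_rgt0 // invr_lt0 pmulr_llt0.
Qed.

(** * Gaps between the shadows and the visible polygons *)

Lemma phi_anti j m x : 0 <= x.1 -> 0 <= x.2 -> (j <= m)%N -> (m <= L)%N ->
  phi m x + (m%:R - j%:R) * x.2 <= phi j x.
Proof.
(* The form is [(L - j)^2 * x1 - j * x2], and on the quadrant both terms are nonincreasing in [j] up
   to [L]. *)
elim/pt2_ind: x => x1 x2 /= h1 h2 jm mL; rewrite /aff /ray /curve /=.
have hj : j%:R <= m%:R :> R by rewrite ler_nat.
have hm : m%:R <= L%:R :> R by rewrite ler_nat.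
have : (L%:R - m%:R) ^+ 2 <= (L%:R - j%:R) ^+ 2 :> R.
  by rewrite ler_sqr ?nnegrE; lra.
move: (_ ^+ 2) (_ ^+ 2) => u v uv; nra.
Qed.

Lemma phi_le j m x : 0 <= x.1 -> 0 <= x.2 -> (j <= m)%N -> (m <= L)%N ->
  phi m x <= phi j x.
Proof.
move=> h1 h2 jm mL; apply: le_trans (phi_anti h1 h2 jm mL).
by rewrite lerDl mulr_ge0 // subr_ge0 ler_nat.
Qed.

Lemma phi_lt j m x : 0 <= x.1 -> 0 < x.2 -> (j < m)%N -> (m <= L)%N ->
  phi m x < phi j x.
Proof.
move=> h1 h2 jm mL; apply: lt_le_trans (phi_anti h1 (ltW h2) (ltnW jm) mL).
by rewrite ltrDl mulr_gt0 // subr_gt0 ltr_nat.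
Qed.

(* All sectors from k.*2 on are flat, so the last gap extends to the x-axis. *)
Definition gap_end s := if s.+1 == k then L else s.*2.+2.

Definition in_gap s x := 0 < phi s.*2.+1 x /\ phi (gap_end s) x < 0.

Lemma gap_endP s : (s < k)%N -> (s.*2.+1 < gap_end s <= L)%N.
Proof. by rewrite /gap_end; case: ifP => [|/eqP] h sk; lia. Qed.

Lemma shape_quadrant F x : shape F x -> 0 <= x.1 /\ 0 <= x.2.
Proof. by move=> /shape_big[]; rewrite /aff /=; split; lra. Qed.

Lemma shape_interior_quadrant F x : (shape F)° x -> 0 < x.1 /\ 0 < x.2.
Proof.
move=> h; have /big_interiorP[] : big_triangle° x.
  by apply: filterS h => y; exact: shape_big.
by rewrite /aff /=; split; lra.
Qed.

Lemma in_gap_not_peak s s' x : 0 <= x.1 -> 0 <= x.2 -> (s < k)%N -> (s' < k)%N ->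
  in_gap s x -> ~ in_peak s' x.
Proof.
move=> x1 x2 sk sk' [h1 h2] [h3 h4]; have := gap_endP sk => ge.
have [ss|ss] := leqP s' s.
  by have := @phi_le s'.*2.+1 s.*2.+1 x x1 x2 ltac:(lia) ltac:(lia); lra.
have ge2 : gap_end s = s.*2.+2 by rewrite /gap_end; case: ifP => // /eqP; lia.
rewrite ge2 in h2.
by have := @phi_le s.*2.+2 s'.*2 x x1 x2 ltac:(lia) ltac:(lia); lra.
Qed.

(** Such a ray bounds the cone of a pyramid, so a point on it can be pushed into the shadow by an
    arbitrarily small step. The step goes along the other bounding ray of the same cone. *)
Lemma back_interior_ray i j x : valid (Back i) -> (0 < j < k.*2)%N ->
  (visible_part T viewpoint (corners (Back i)))° x -> phi j x != 0.
Proof.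
move=> vF jk Vx; apply/eqP => j0.
have Sx : (shape (Back i))° x by apply: filterS Vx => y /(back_visible _ vF)[].
have [x1 x2] := shape_interior_quadrant Sx.
have [s [sk]] : exists s, (s < k)%N /\ (j = s.*2 \/ j = s.*2.+1).
  by exists j./2; lia.
have hit (d : pt2 R) : ~ (forall r : R, 0 < r -> in_peak s (x + r *: d)).
  have [u u0 Hu] := near_line d Vx.
  move=> /(_ (u / 2)); have u2 : 0 < u / 2 by lra.
  move=> /(_ u2); have /Hu : `|u / 2| < u by rewrite gtr0_norm //; lra.
  by move/(back_visible _ vF) => [_ /(_ s sk)].
move=> -[jE|jE].
  apply: (hit (e s.*2.+1)) => r r0; rewrite /in_peak !affD_ray !affZ_ray -jE j0 jE.
  rewrite ray_curve_eq0 mulr0 addr0 add0r mulr_gt0 ?ray_curve_gt0 //; last lia.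
  split => //; rewrite -j0 jE; apply: phi_lt => //; [exact: ltW|lia].
apply: (hit (e s.*2)) => r r0; rewrite /in_peak !affD_ray !affZ_ray -jE j0 jE.
rewrite ray_curve_eq0 mulr0 addr0 add0r pmulr_rlt0 // ray_curve_lt0 //; last lia.
split => //; rewrite -j0 jE; apply: phi_lt => //; [exact: ltW|lia].
Qed.

Lemma back_interior i x : valid (Back i) ->
  (visible_part T viewpoint (corners (Back i)))° x <->
  (shape (Back i))° x /\ exists2 s, (s < k)%N & in_gap s x.
Proof.
move=> vF; split.
  move=> Vx; have Sx : (shape (Back i))° x by apply: filterS Vx => y /(back_visible _ vF)[].
  have [x1 x2] := shape_interior_quadrant Sx; split => //.
  have [_ np] := (back_visible _ vF).1 (nbhs_singleton Vx).
  apply: contrapT => nogap.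
  have nz j : (0 < j < k.*2)%N -> phi j x != 0 by move=> jk; exact: back_interior_ray jk Vx.
  have step s : (s < k)%N -> 0 < phi s.*2 x -> 0 < phi s.*2.+1 x.
    move=> sk p0; rewrite lt_neqAle eq_sym nz /=; last lia.
    by rewrite leNgt; apply/negP => p1; apply: (np s sk).
  (* A point that is in no shadow, no gap and on no ray passes one ray after the other. Having
     passed the last pyramid, it lies in the last gap after all. *)
  have all s : (s < k)%N -> 0 < phi s.*2.+1 x.
    elim: s => [|s IH] sk.
      apply: step => //; have -> : phi 0 x = L%:R ^+ 2 * x.1 by rewrite /aff /ray /=; ring.
      by rewrite mulr_gt0 // exprn_gt0 // ltr0n; lia.
    apply: step => //; rewrite ltNge; apply/negP; rewrite le_eqVlt => /orP[/eqP h|h].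
      by have := nz s.+1.*2; rewrite h eqxx; move=> /(_ ltac:(lia)).
    apply: nogap; exists s; first lia; split; first by apply: IH; lia.
    by rewrite /gap_end; case: ifP => [/eqP|]; [lia|].
  apply: nogap; exists k.-1; first lia; split; first by apply: all; lia.
  rewrite /gap_end prednK // eqxx.
  have -> : phi L x = - (L%:R * x.2) by rewrite /aff /ray /=; ring.
  by rewrite oppr_lt0 mulr_gt0 // ltr0n; lia.
move=> [Sx [s sk [h1 h2]]].
have h3 : 0 < aff (opp_line (ray R L (gap_end s))) x by rewrite aff_opp oppr_gt0.
apply: (filterS _ (filterI Sx (filterI (aff_gt0_near h1) (aff_gt0_near h3)))).
move=> y /= [Sy [h4]]; rewrite aff_opp oppr_gt0 => h5; apply/back_visible => //.
split => // s' sk'; have [y1 y2] := shape_quadrant Sy.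
exact: (in_gap_not_peak y1 y2 sk).
Qed.

Definition bline1 F := bary_line (proj (corner1 F)) (proj (corner2 F)) (proj (corner3 F)).
Definition bline2 F := bary_line (proj (corner2 F)) (proj (corner3 F)) (proj (corner1 F)).
Definition bline3 F := bary_line (proj (corner3 F)) (proj (corner1 F)) (proj (corner2 F)).

Lemma aff_bline F x : (aff (bline1 F) x = bary1 F x) *
  (aff (bline2 F) x = bary2 F x) * (aff (bline3 F) x = bary3 F x).
Proof. by do !split; exact: aff_bary_line. Qed.

Lemma convex_interior_shape F : valid F -> convex_in (shape F)°.
Proof.
move=> vF x y t /(shape_interiorP x vF)[x1 x2 x3] /(shape_interiorP y vF)[y1 y2 y3] t01.
move: x1 x2 x3 y1 y2 y3; rewrite -!(aff_bline F x) -!(aff_bline F y) => x1 x2 x3 y1 y2 y3.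
apply/(shape_interiorP _ vF); rewrite -!(aff_bline F (x + t *: (y - x))).
by split; [exact: (convex_aff_gt0 x1 y1)|exact: (convex_aff_gt0 x2 y2)|exact: (convex_aff_gt0 x3 y3)].
Qed.

Lemma convex_in_gap s : convex_in (in_gap s).
Proof.
move=> x y t [x1 x2] [y1 y2] t01; split; first exact: (convex_aff_gt0 x1 y1 t01).
rewrite -oppr_gt0 -aff_opp; apply: (convex_aff_gt0 _ _ t01); by rewrite /= aff_opp oppr_gt0.
Qed.

Lemma front_polygon F C : valid F -> corner1 F = P0 ->
  visible_polygon T viewpoint (corners F) C -> C = (shape F)°.
Proof.
move=> vF F1 [x]; rewrite front_visible // => Sx ->.
by rewrite connected_component_id //; apply: convex_connected; exact: convex_interior_shape.
Qed.

(** The forms that bound a gap do not vanish on the interior of the visible part, so a component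
    cannot leave its gap; conversely the triangle cut by the gap is convex, hence within one
    component. *)
Lemma back_polygonP i C : valid (Back i) ->
  visible_polygon T viewpoint (corners (Back i)) C <->
  exists s, [/\ (s < k)%N, C !=set0 & C = (shape (Back i))° `&` in_gap s].
Proof.
move=> vF.
have comp s x : (s < k)%N -> (shape (Back i))° x -> in_gap s x ->
    connected_component (visible_part T viewpoint (corners (Back i)))° x =
    (shape (Back i))° `&` in_gap s.
  move=> sk Sx gx; set V := (visible_part _ _ _)°.
  have Vx : V x by apply/back_interior => //; split => //; exists s.
  apply/seteqP; split; last first.
    apply: connected_component_max => //.
    - by move=> y [Sy gy]; apply/back_interior => //; split => //; exists s.
    - apply: convex_connected; apply: convex_inI; first exact: convex_interior_shape.
      exact: convex_in_gap.
  move=> y Cy; have sub := connected_component_sub (A := V) (x := x).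
  have [Sy _] := (back_interior _ vF).1 (sub _ Cy).
  have cC := @component_connected _ V x; have Cx := connected_component_refl Vx.
  split => //; split.
    apply: (connected_aff_gt0 cC _ Cx _ Cy); last by case: gx.
    by move=> z /sub; apply: back_interior_ray => //; lia.
  rewrite -oppr_gt0 -aff_opp.
  apply: (connected_aff_gt0 cC _ Cx _ Cy); last by rewrite aff_opp oppr_gt0; case: gx.
  (* The last gap ends at the x-axis, which is no shadow boundary; there the form is nonzero because
     the point is interior to the domain. *)
  move=> z /sub Vz; rewrite aff_opp oppr_eq0 /gap_end; case: ifP => [_|/eqP sk1].
    have [Sz _] := (back_interior _ vF).1 Vz; have [z1 z2] := shape_interior_quadrant Sz.
    have -> : phi L z = - (L%:R * z.2) by rewrite /aff /ray /=; ring.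
    by rewrite oppr_eq0 mulf_neq0 ?gt_eqF // ltr0n; lia.
  by apply: back_interior_ray Vz => //; lia.
split=> [[x Vx ->]|[s [sk [x Cx] CE]]].
  have [Sx [s sk gx]] := (back_interior _ vF).1 Vx.
  by exists s; split => //; [exists x; exact: connected_component_refl|exact: comp].
rewrite CE in Cx *; case: Cx => Sx gx.
exists x; last by rewrite (comp s).
by apply/back_interior => //; split => //; exists s.
Qed.

(** * Counting the vertices of the viewshed *)

(** [None] serves the facets at the viewpoint, which are visible as a whole, and [Some s] the part
    of a facet [Back i] seen through gap [s]. *)
Definition polygon F (o : option nat) : set (pt2 R) :=
  if o is Some s then (shape F)° `&` in_gap s else (shape F)°.

(* Padded with the constant 1 when the polygon is not cut by a gap. *)
Definition sides F (o : option nat) (i : 'I_5) : R * R * R :=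
  nth (0, 0, 1) [:: bline1 F; bline2 F; bline3 F;
    (if o is Some s then ray R L s.*2.+1 else (0, 0, 1));
    (if o is Some s then opp_line (ray R L (gap_end s)) else (0, 0, 1))] i.

Lemma polygonP F o x : valid F -> polygon F o x <-> forall i, 0 < aff (sides F o i) x.
Proof.
move=> vF; have aff1 : 0 < aff (0, 0, 1) x by rewrite /aff /= !mul0r !add0r.
split.
  move=> pF.
  have [h1 h2 h3] : [/\ 0 < bary1 F x, 0 < bary2 F x & 0 < bary3 F x].
    by apply/shape_interiorP => //; move: pF; rewrite /polygon; case: (o) => [s []|].
  move=> [[|[|[|[|[|//]]]]] /= i5]; rewrite /sides /=.
  - by rewrite aff_bline.
  - by rewrite aff_bline.
  - by rewrite aff_bline.
  - by move: pF; case: (o) => [s [_ []]|].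
  - by move: pF; case: (o) => [s [_ []]|] //; rewrite aff_opp oppr_gt0.
move=> H; have Hi m (m5 : (m < 5)%N) := H (Ordinal m5).
have Sx : (shape F)° x.
  apply/shape_interiorP => //.
  have := Hi 0%N isT; have := Hi 1%N isT; have := Hi 2%N isT.
  by rewrite /sides /= !aff_bline.
have := Hi 3%N isT; have := Hi 4%N isT; rewrite /sides /= /polygon; case: (o) => [s|] //.
by rewrite aff_opp oppr_gt0 => g1 g2; split.
Qed.

(** Puts the facets into a finite index set, so that they can be counted; [t < 5] keeps the default
    of [nth] out of reach. *)
Definition facet_of (t : 'I_5) (i : 'I_n) : facet :=
  nth (Back i) [:: Back i; Flat i; FLeft i; FRight i; Far i] t.

Lemma facet_ofP F : valid F -> exists t i, F = facet_of t i.
Proof.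
move=> vF; have [m mn FE] : exists2 m, (m < n)%N &
    [\/ F = Back m, F = Flat m | [\/ F = FLeft m, F = FRight m | F = Far m]].
  by case: F vF => m /= vm; exists m; rewrite /n; try lia;
    try (by constructor); constructor 3; constructor.
case: FE => [->|->|[->|->|->]].
- by exists (Ordinal (isT : 0 < 5)%N), (Ordinal mn).
- by exists (Ordinal (isT : 1 < 5)%N), (Ordinal mn).
- by exists (Ordinal (isT : 2 < 5)%N), (Ordinal mn).
- by exists (Ordinal (isT : 3 < 5)%N), (Ordinal mn).
- by exists (Ordinal (isT : 4 < 5)%N), (Ordinal mn).
Qed.

(** A code consists of a kind and an index of a facet, an optional gap and an ordered pair of the
    five sides. Codes with an invalid facet or parallel sides only enlarge the count, which serves
    as an upper bound. *)
Definition candidate (c : 'I_5 * 'I_n * option 'I_k * ('I_5 * 'I_5)) :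
    {set 'I_n} * set (pt2 R) * pt2 R :=
  let F := facet_of c.1.1.1 c.1.1.2 in
  let o := omap (@nat_of_ord k) c.1.2 in
  (corners F, polygon F o, meet_point (sides F o c.2.1) (sides F o c.2.2)).

Lemma viewshed_vertices_candidate : viewshed_vertices T viewpoint `<=` range candidate.
Proof.
move=> [[f C] q] [/= /facet_setsP[F vF ->] vC pq].
have Cne : C !=set0.
  by case: vC => x Vx ->; exists x; exact: connected_component_refl.
have [g CE] : exists g : option 'I_k, C = polygon F (omap (@nat_of_ord k) g).
  case: F vF vC => s vF.
  - move=> /(back_polygonP _ vF)[r [rk _ ->]].
    by exists (Some (Ordinal rk)).
  - by move=> /(front_polygon vF erefl) ->; exists None.
  - by move=> /(front_polygon vF erefl) ->; exists None.
  - by move=> /(front_polygon vF erefl) ->; exists None.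
  - by move=> [x]; rewrite far_invisible.
have [a [b qE]] : exists a b,
    q = meet_point (sides F (omap (@nat_of_ord k) g) a)
                   (sides F (omap (@nat_of_ord k) g) b).
  apply: (polygon_vertex_meet Cne) => // x; rewrite CE; exact: polygonP.
have [t [i FE]] := facet_ofP vF.
by exists (t, i, g, (a, b)) => //; rewrite /candidate /= -FE CE qE.
Qed.

(** * The lower bound: one corner for each long triangle and each gap *)

Definition crossing_ratio i s : R :=
  - phi s.*2.+1 (e 0) / (phi s.*2.+1 (e i) - phi s.*2.+1 (e 0)).

(* The common point of the ray through e s.*2.+1 and the segment from e 0 to e i,
   a corner of the visible polygon of gap s on Back i. *)
Definition crossing i s : pt2 R :=
  (1 - crossing_ratio i s) *: e 0 + crossing_ratio i s *: e i.

Lemma crossing_ratio_itv i s : (k.*2 <= i < L)%N -> (s < k)%N ->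
  0 < crossing_ratio i s < 1.
Proof.
move=> iL sk; rewrite /crossing_ratio; set j := s.*2.+1.
have p0 : phi j (e 0) < 0 by rewrite ray_curve_lt0 /j //; lia.
have pi : 0 < phi j (e i) by rewrite ray_curve_gt0 /j //; lia.
have d0 : 0 < phi j (e i) - phi j (e 0) by lra.
by rewrite divr_gt0 ?oppr_gt0 //= ltr_pdivrMr // mul1r; lra.
Qed.

Lemma crossing_on_ray i s : (k.*2 <= i < L)%N -> (s < k)%N ->
  exists2 t : R, 0 < t & crossing i s = t *: e s.*2.+1.
Proof.
move=> iL sk; have /andP[] := crossing_ratio_itv iL sk.
have phq : phi s.*2.+1 (crossing i s) = 0.
  rewrite /crossing affD_ray !affZ_ray.
  have uE : crossing_ratio i s * (phi s.*2.+1 (e i) - phi s.*2.+1 (e 0)) = - phi s.*2.+1 (e 0).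
    rewrite mulfVK // gt_eqF // subr_gt0.
    by apply: (@lt_trans _ _ 0); [rewrite ray_curve_lt0|rewrite ray_curve_gt0] => //; lia.
  by move: uE; rewrite mulrBr mulrBl mul1r; lra.
have q1 : (crossing i s).1 = crossing_ratio i s * i%:R by rewrite /crossing /= scaler0 add0r.
move: phq q1; move: (crossing i s) (crossing_ratio i s) => q u phq q1 u0 u1.
set j := s.*2.+1.
have j0 : 0 < j%:R :> R by rewrite ltr0n.
have i0 : 0 < i%:R :> R by rewrite ltr0n; lia.
exists (u * (i%:R / j%:R)); first by rewrite mulr_gt0 // divr_gt0.
have q2 : q.2 * j%:R = q.1 * (L%:R - j%:R) ^+ 2.
  move: phq; rewrite /aff /ray /line /= -/j; move: (q.1) (q.2) => a b; move: (_ ^+ 2) => c.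
  by rewrite !subr0 !mulr0 mul0r subrr addr0 sub0r => h; lra.
rewrite [LHS]surjective_pairing; congr pair.
  by rewrite q1 /= /GRing.scale /= mulrA mulfVK // gt_eqF.
apply: (mulIf (lt0r_neq0 j0)); rewrite q2 q1 /= /GRing.scale /=.
by rewrite [RHS]mulrAC -[u * _ * j%:R]mulrA divfK ?gt_eqF.
Qed.

Lemma aff_crossing l i s : aff l (crossing i s) =
  (1 - crossing_ratio i s) * aff l (e 0) + crossing_ratio i s * aff l (e i).
Proof.
rewrite /crossing; move: (crossing_ratio i s) (e 0) (e i) => u x y.
by elim/pt2_ind: x => ? ?; elim/pt2_ind: y => ? ?; rewrite !ptE /aff /=; ring.
Qed.

Lemma back_shape_interior i x : valid (Back i) -> (shape (Back i))° x <->
  [/\ 0 < signed_area (e i) (e i.+1) x, 0 < signed_area (e i.+1) (e 0) x &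
      0 < signed_area (e 0) (e i) x].
Proof.
move=> vF; rewrite shape_interiorP // /bary1 /bary2 /bary3.
have := projsE vF => -[-> -> ->].
have D : 0 < signed_area (e 0) (e i) (e i.+1).
  by move: (vF) => /= iL; rewrite area_curve_gt0 //; lia.
have D1 : 0 < signed_area (e i) (e i.+1) (e 0) by rewrite area_rot.
have D2 : 0 < signed_area (e i.+1) (e 0) (e i) by rewrite area_rot area_rot.
by rewrite /bary !pmulr_lgt0 ?invr_gt0.
Qed.

(** Since [s.*2.+1 < k.*2 <= i], the ray separates [e 0] from [e i] and meets the segment between
    them in an inner point. There the remaining sides of the polygon are strictly positive, so only
    two lines shape it locally. *)
Lemma crossing_vertex i s : (k.*2 <= i < L)%N -> (s < k)%N ->
  polygon_vertex (polygon (Back i) (Some s)) (crossing i s).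
Proof.
move=> iL sk; have /andP[u0 u1] := crossing_ratio_itv iL sk.
have [t t0 qt] := crossing_on_ray iL sk.
have vF : valid (Back i) by move=> /=; lia.
have h1 : 0 < aff (line (e i) (e i.+1)) (crossing i s).
  rewrite aff_crossing !aff_line area_refl mulr0 addr0 mulr_gt0 //; first by rewrite subr_gt0.
  by rewrite area_rot area_curve_gt0 //; lia.
have h2 : 0 < aff (line (e i.+1) (e 0)) (crossing i s).
  rewrite aff_crossing !aff_line area_refl mulr0 add0r mulr_gt0 //.
  by rewrite area_rot area_rot area_curve_gt0 //; lia.
have h3 : 0 < aff (opp_line (ray R L (gap_end s))) (crossing i s).
  by rewrite aff_opp qt affZ_ray oppr_gt0 pmulr_rlt0 // ray_curve_lt0 //; have := gap_endP sk; lia.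
have ij : s.*2.+1%:R + 1 <= i%:R :> R by rewrite natr1 ler_nat; lia.
have iL' : i%:R <= L%:R :> R by rewrite ler_nat; lia.
have j1 : 1 <= s.*2.+1%:R :> R by rewrite ler1n.
(* The two directions are those of the fan diagonal and of the ray, oriented into the polygon. *)
apply: (@polygon_vertex_corner R _ (line (e 0) (e i)) (ray R L s.*2.+1) _ (e i - e 0) (e s.*2.+1)).
- apply: (filterS _ (filterI (aff_gt0_near h1) (filterI (aff_gt0_near h2) (aff_gt0_near h3)))).
  move=> x /= [x1 [x2 x3]]; rewrite aff_line in x1; rewrite aff_line in x2.
  rewrite aff_opp oppr_gt0 in x3; rewrite aff_line.
  split=> [[/(back_shape_interior _ vF)[_ _ y3] [y4 _]] //|[y3 y4]].
  by split; [apply/back_shape_interior|split].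
- by rewrite aff_crossing !aff_line !area_refl !mulr0 addr0.
- by rewrite qt affZ_ray ray_curve_eq0 mulr0.
- by rewrite /line /curve /=; ring.
- rewrite [X in 0 < X](_ : _ = phi s.*2.+1 (e i) - phi s.*2.+1 (e 0)).
    rewrite subr_gt0; apply: (@lt_trans _ _ 0).
      by rewrite ray_curve_lt0 //; lia.
    by rewrite ray_curve_gt0 //; lia.
  by rewrite /aff /ray /line /curve /=; ring.
- rewrite /line /curve /=; move: ij iL' j1.
  move: (s.*2.+1%:R) (i%:R) (L%:R) => j' i' L' ij iL' j1.
  rewrite mulr0n !subr0.
  rewrite [X in 0 < X](_ : _ = i' * (L' ^+ 2 - j' * (i' - j'))); last by ring.
  rewrite mulr_gt0 //; first lra.
  rewrite subr_gt0 expr2; nra.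
- by rewrite /ray /line /curve /=; ring.
Qed.

Definition crossing_record (c : 'I_(L - k.*2) * 'I_k) :
    {set 'I_n} * set (pt2 R) * pt2 R :=
  (corners (Back (k.*2 + c.1)), polygon (Back (k.*2 + c.1)) (Some (c.2 : nat)),
   crossing (k.*2 + c.1) c.2).

Lemma crossing_record_vertex : range crossing_record `<=` viewshed_vertices T viewpoint.
Proof.
move=> _ [[i s] _ <-]; rewrite /crossing_record /=.
have iL : (k.*2 <= k.*2 + i < L)%N by have := ltn_ord i; lia.
have sk := ltn_ord s.
have pv := crossing_vertex iL sk.
have vF : valid (Back (k.*2 + i)) by move=> /=; lia.
split => //=; first exact: facet_sets_corners.
apply/back_polygonP => //; exists s; split => //.
by case: pv => /(_ setT filterT) [x [Cx _]] _ _; exists x.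
Qed.

(** The corners determine [i], as each index must be the other one or its successor and [E 0] is
    excluded by [k_gt0]. The crossing point lies on a ray from 0 that determines [s]. *)
Lemma crossing_record_inj : injective crossing_record.
Proof.
move=> [i s] [i' s'] h.
have cE : corners (Back (k.*2 + i)) = corners (Back (k.*2 + i')) := congr1 (fun c => c.1.1) h.
have qE : crossing (k.*2 + i) s = crossing (k.*2 + i') s' := congr1 snd h.
have [iL iL'] := (ltn_ord i, ltn_ord i').
have ii : i = i'.
  apply: val_inj => /=.
  have h1 : E (k.*2 + i) \in corners (Back (k.*2 + i')) by rewrite -cE !inE eqxx orbT.
  have h2 : E (k.*2 + i') \in corners (Back (k.*2 + i)) by rewrite cE !inE eqxx orbT.
  have Einj a b : (a <= L)%N -> (b <= L)%N -> E a == E b -> a = b.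
    by move=> aL bL /eqP /(congr1 val) /=; rewrite !val_E.
  move: h1 h2; rewrite !inE /= => /orP[/orP[]|] /Einj h1 /orP[/orP[]|] /Einj h2;
    move: (h1 ltac:(lia) ltac:(lia)) (h2 ltac:(lia) ltac:(lia)); lia.
suff ss : s = s' by rewrite ii ss.
apply: val_inj => /=.
have [t t0 qt] := @crossing_on_ray (k.*2 + i) s ltac:(lia) (ltn_ord s).
have [t' t'0 qt'] := @crossing_on_ray (k.*2 + i') s' ltac:(lia) (ltn_ord s').
have tt : t *: e s.*2.+1 = t' *: e s'.*2.+1 by rewrite -qt -qt' qE.
have [sk sk'] := (ltn_ord s, ltn_ord s').
case: (ltngtP s s') => // ss; exfalso.
  have : phi s.*2.+1 (t' *: e s'.*2.+1) = 0 by rewrite -tt affZ_ray ray_curve_eq0 mulr0.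
  by apply/eqP; rewrite affZ_ray mulf_neq0 ?gt_eqF // ray_curve_gt0 //; lia.
have : phi s'.*2.+1 (t *: e s.*2.+1) = 0 by rewrite tt affZ_ray ray_curve_eq0 mulr0.
by apply/eqP; rewrite affZ_ray mulf_neq0 ?gt_eqF // ray_curve_gt0 //; lia.
Qed.

Lemma viewpoint_on_surface : surface T viewpoint.
Proof.
apply/surfaceP; exists (FLeft 0) => //; exists 1, 0, 0; split => //; rewrite ?addr0 //.
by rewrite scale1r !scale0r !addr0.
Qed.

Lemma fan_viewshed_complexity : exists m, [/\ has_viewshed_complexity T viewpoint m,
  ((L - k.*2) * k <= m)%N & (m <= 5 * n * k.+1 * 25)%N].
Proof.
have /finite_setP[m Vm] : finite_set (viewshed_vertices T viewpoint).
  apply: sub_finite_set viewshed_vertices_candidate _.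
  by apply: finite_image; exact: finite_finset.
exists m; split => //.
  have := card_ge_range crossing_record_inj crossing_record_vertex Vm.
  by rewrite card_prod !card_ord.
have := card_le_range viewshed_vertices_candidate Vm.
by rewrite !card_prod card_option !card_ord.
Qed.

End Facets.

Theorem theorem5 (R : realType) :
  exists (c1 c2 : R) (K : nat), [/\ 0 < c1, 0 < c2 &
    forall n k : nat, (0 < k)%N -> (K * k <= n)%N ->
      exists (T : terrain R n) (p : pt3 R) (m : nat),
        [/\ prickliness T = k,
            surface T p,
            has_viewshed_complexity T p m,
            c1 * (n * prickliness T)%:R <= m%:R &
            m%:R <= c2 * (n * prickliness T)%:R]].
Proof.
(* With [n = k + L + 2], the bound [10 * k <= n] gives [n <= 2 * (L - 2 * k)], already sharp at
   [k = 1], [n = 10]. The constant 250 is [2 * 5 * 25], from [k + 1 <= 2 * k]. *)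
exists (1 / 2), 250, 10%N; split; [lra|lra|] => n k k0 nk.
have [L nE] : exists L, n = (k + L.+1).+1 by exists (n - 2 - k)%N; lia.
subst n; have kL : (k.*2 < L)%N by lia.
have [m [Vm m1 m2]] := fan_viewshed_complexity R k0 kL.
exists (fan R k0 kL), (vertex R (origin_vtx L k)), m.
rewrite prickliness_fan; split => //; first exact: viewpoint_on_surface.
  have h : ((k + L.+1).+1 * k <= 2 * m)%N by nia.
  have : ((k + L.+1).+1 * k)%:R <= (2 * m)%:R :> R by rewrite ler_nat.
  by rewrite [(2 * m)%:R]natrM; lra.
have h : (m <= 250 * ((k + L.+1).+1 * k))%N by nia.
have : m%:R <= (250 * ((k + L.+1).+1 * k))%:R :> R by rewrite ler_nat.
by rewrite [(250 * _)%:R]natrM.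
Qed.
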